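(* Let $k=k(n)\in\{1,\ldots,n\}$ be such that $\lim_{n\to\infty}k(n)/n=\alpha$ for some constant $\alpha\in(0,1)$. Then, as $n\to\infty$, $$\frac{\mathrm{Lah}(n,k)-\mathbb{E}\,\mathrm{Lah}(n,k)}{\sqrt n}\longrightarrow\mathrm{N}\left(0,-\left(\frac{\alpha}{1-\alpha}+\frac{\alpha(\alpha+1)\log\alpha}{(1-\alpha)^2}+\frac{\alpha^2\log^2\alpha}{(1-\alpha)^3}\right)\right)\quad\text{in distribution.}$$
   Context: $\genfrac{[}{]}{0pt}{}{n}{j}$ and $\genfrac{\{}{\}}{0pt}{}{j}{k}$ denote the (unsigned) Stirling numbers of the first and second kind, respectively, and $L(n,k)=\sum_{j=k}^n\genfrac{[}{]}{0pt}{}{n}{j}\genfrac{\{}{\}}{0pt}{}{j}{k}=\frac{n!}{k!}\binom{n-1}{k-1}$ is the Lah number. For $n\in\mathbb{N}$, $k\in\{1,\ldots,n\}$, $\mathrm{Lah}(n,k)$ denotes a random variable with distribution $\mathbb{P}[\mathrm{Lah}(n,k)=j]=\frac{1}{L(n,k)}\genfrac{[}{]}{0pt}{}{n}{j}\genfrac{\{}{\}}{0pt}{}{j}{k}$ for $j\in\{k,k+1,\ldots,n\}$. $\mathrm{N}(m,\sigma^2)$ denotes a normal random variable with mean $m\in\mathbb{R}$ and variance $\sigma^2>0$. *)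

(* Defs.v *)
From HB Require Import structures.
From mathcomp Require Import all_boot all_order all_algebra perm.

Set Implicit Arguments.
Unset Strict Implicit.
Unset Printing Implicit Defensive.

(* Stated before classical_sets is imported, so that [set _ | _] is a finset. *)

(* Number of permutations of n points with exactly j cycles. *)
Definition stirling1 (n j : nat) : nat :=
  #|[set s : 'S_n | #|porbits s| == j]|.

(* Number of partitions of an n-set into exactly k (nonempty) blocks. *)
Definition stirling2 (n k : nat) : nat :=
  #|[set Q : {set {set 'I_n}} | partition Q [set: 'I_n] & #|Q| == k]|.

Definition lah (n k : nat) : nat :=
  (\sum_(k <= j < n.+1) stirling1 n j * stirling2 j k)%N.

From mathcomp Require Import all_classical all_reals all_analysis.
From mathcomp Require Import measurable_realfun.

Import Order.TTheory GRing.Theory Num.Theory.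
Import numFieldNormedType.Exports.

Local Open Scope classical_set_scope.
Local Open Scope ring_scope.

Definition lah_pmf (R : realType) (n k j : nat) : R :=
  (stirling1 n j * stirling2 j k)%:R / (lah n k)%:R.

(* No condition is needed outside {k, ..., n}: the masses prescribed on
   {k, ..., n} already add up to 1. *)
Definition lah_distributed d (T : measurableType d) (R : realType)
    (P : probability T R) (X : {RV P >-> R}) (n k : nat) : Prop :=
  forall j : nat, (k <= j <= n)%N ->
    distribution P X [set j%:R] = (lah_pmf R n k j)%:E.

Definition center_scale d (T : measurableType d) (R : realType)
    (P : probability T R) (X : {RV P >-> R}) (c : R) : T -> R :=
  fun w => (X w - fine 'E_P[X]) / c.

Arguments lah_distributed {d T R} P X n k.
Arguments center_scale {d T R} P X c _.

Section center_scale_measurable.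
Context d (T : measurableType d) (R : realType) (P : probability T R)
  (X : {RV P >-> R}) (c : R).

Let measurable_center_scale : measurable_fun [set: T] (center_scale P X c).
Proof. by apply: measurable_funM => //; exact: measurable_funB. Qed.

HB.instance Definition _ :=
  @isMeasurableFun.Build _ _ _ _ (center_scale P X c) measurable_center_scale.

End center_scale_measurable.

(* The random variables may live on different probability spaces; mu is the
   limit law. *)
Definition cvg_in_distribution (R : realType) (d : nat -> measure_display)
    (T : forall n, measurableType (d n)) (P : forall n, probability (T n) R)
    (X : forall n, {RV (P n) >-> R})
    (mu : probability (measurableTypeR R) R) : Prop :=
  forall x : R, {for x, continuous (fun y : R => mu `]-oo, y]%classic)} ->
    cdf (X n) x @[n --> \oo] --> mu `]-oo, x]%classic.

Arguments cvg_in_distribution {R d T} P X mu.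

Definition lah_asymptotic_var (R : realType) (a : R) : R :=
  - (a / (1 - a) + a * (a + 1) * ln a / (1 - a) ^+ 2
     + a ^+ 2 * ln a ^+ 2 / (1 - a) ^+ 3).

(* Main.v *)
From HB Require Import structures.
Require Import Defs.
From mathcomp Require Import all_boot all_order all_algebra fingroup perm.

(** A Lah configuration is a permutation of n points together with a grouping
    of its cycles into k blocks; under the uniform law the number of cycles is
    distributed as Lah(n,k). Deleting one point gives a Markov chain: the point
    lies in a longer cycle, or is a cycle of its own in a block with other
    cycles, or is a block of its own, and in the last case k drops by one. The
    probabilities are explicit because the Lah numbers have a closed form
    (lah_mean_rec). So Lah(n,k) is a sum of 0-1 increments along a chain, and
    the central limit theorem is obtained by the method of Lindeberg.

    Mean and variance satisfy the recursions that the chain gives, and are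
    solved by closed forms (lah_avgE, lah_varE) in the sums of 1/i and of 1/i^2
    over k <= i <= n. These sums tend to - log alpha and, after multiplication
    by n, to (1 - alpha) / alpha, so the variance divided by n tends to the
    variance v of the theorem (cvg_lah_var). Positivity of v comes from
    log x < x - 1 (lah_asymptotic_var_gt0).

    Let heat w x = Phi (x / sqrt w), with Phi the standard normal distribution
    function, and put h = 1 / sqrt n. The expectation of
    heat w (b - h Lah(n,k)) is compared with heat (w + h^2 V) (b - h E), where
    E and V are the mean and variance of Lah(n,k). The function heat solves the
    heat equation, and in one step of the chain the conditional means are
    averaged correctly (step_centered) and the conditional variances obey the
    law of total variance (step_second_moment). Hence the terms of first and
    second order in h cancel, one step costs O(h^3) (heat_step), and the n
    steps cost O(n h^3) = O(n^(-1/2)) (lah_heat_comparison).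

    The cost of a step is controlled uniformly in n and k by step_moment_bound.
    The danger lies in the rare steps where k drops, because the mean and the
    variance then jump by amounts that are not bounded when k / n is small.
    The jump eta of the mean is at most n / (2k) and its square at most 2n / k
    (gap_bounds); the jump of the variance is at most 10 n / k (lah_var_gap);
    and a drop has probability at most (k / n)^2, which compensates
    (step_mean_bounds).

    Finally an indicator of a half-line lies between two functions
    heat (delta^2) shifted by K delta in either direction, up to the normal
    tails beyond K (lah_cdf_sandwich); letting n tend to infinity, then delta
    to 0 and K to infinity gives the convergence of the distribution functions
    (cvg_lah_cdf). *)

Set Implicit Arguments.
Unset Strict Implicit.
Unset Printing Implicit Defensive.

(** * Stirling numbers *)

Section Stirling1.
Import GroupScope.

Lemma lift_permX n (i : 'I_n.+1) (s : 'S_n) m :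
  lift_perm i i s ^+ m = lift_perm i i (s ^+ m).
Proof.
elim: m => [|m IH]; first by rewrite !expg0 lift_perm1.
by rewrite !expgS IH lift_permM.
Qed.

Lemma porbits_lift_perm n (i : 'I_n.+1) (s : 'S_n) :
  #|porbits (lift_perm i i s)| = #|porbits s|.+1.
Proof.
have fixi : porbit (lift_perm i i s) i = [set i].
  apply/setP => y; rewrite inE; apply/porbitP/eqP => [[m ->]|->].
    by rewrite lift_permX lift_perm_id.
  by exists 0%N; rewrite expg0 perm1.
have lifti x : porbit (lift_perm i i s) (lift i x) = lift i @: porbit s x.
  apply/setP => y; apply/porbitP/imsetP => [[m ->]|[z /porbitP[m ->] ->]].
    by exists ((s ^+ m) x); rewrite ?mem_porbit // lift_permX lift_perm_lift.
  by exists m; rewrite lift_permX lift_perm_lift.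
have -> : porbits (lift_perm i i s) =
    [set i] |: [set lift i @: (A : {set _}) | A in porbits s].
  apply/setP => A; rewrite !inE; apply/imsetP/orP => [[y _ ->]|].
    case: (unliftP i y) => [x ->|->]; last by left; rewrite fixi.
    by right; rewrite lifti; apply/imsetP; exists (porbit s x) => //; apply: imset_f.
  case=> [/eqP->|/imsetP[_ /imsetP[x _ ->] ->]]; first by exists i.
  by exists (lift i x).
rewrite cardsU1 card_imset; last exact/imset_inj/lift_inj.
rewrite (_ : _ \notin _) //; apply/imsetP => -[A _ /setP/(_ i)].
rewrite set11 => /esym/imsetP[x _ /eqP].
by apply/negP/neq_lift.
Qed.

(** Every permutation of n+1 points is, in exactly one way, a permutation
    fixing the point 0 followed by the transposition of 0 with some point; the
    transposition inserts 0 into one of the n other cycles. *)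
Lemma perm_insert0_bij n :
  bijective (fun u : 'I_n.+1 * 'S_n =>
    tperm ord0 u.1 * lift_perm ord0 ord0 u.2).
Proof.
apply: inj_card_bij => [[i s] [j t] /= eq_st|].
  have eq_ij : i = j.
    have := congr1 (fun u : {perm _} => u^-1 ord0) eq_st.
    by rewrite /= !invMg !permM !lift_permV !lift_perm_id !tpermV !tpermL.
  move: eq_st; rewrite {}eq_ij => /mulgI eq_st; congr (_, _).
  apply/permP => x; have := congr1 (fun u : {perm _} => u (lift ord0 x)) eq_st.
  by rewrite /= !lift_perm_lift => /lift_inj.
by rewrite card_prod card_ord !card_Sn factS.
Qed.

Lemma stirling1_rec n j :
  stirling1 n.+1 j.+1 = (n * stirling1 n j.+1 + stirling1 n j)%N.
Proof.
rewrite {1}/stirling1 -sum1_card (reindex _ (onW_bij _ (perm_insert0_bij n))) /=.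
under eq_bigl do rewrite inE.
rewrite -(pair_big_dep predT
  (fun i (s : 'S_n) => #|porbits (tperm ord0 i * lift_perm ord0 ord0 s)| == j.+1)
  (fun _ _ => 1%N)) /=.
rewrite big_ord_recl /= addnC; congr addn; last first.
  rewrite tperm1 /stirling1 -sum1_card; apply: eq_bigl => s.
  by rewrite mul1g porbits_lift_perm inE eqSS.
transitivity (\sum_(i < n) stirling1 n j.+1)%N; last first.
  by rewrite sum_nat_const card_ord.
apply: eq_bigr => i _; rewrite /stirling1 -sum1_card; apply: eq_bigl => s.
rewrite inE.
have := porbits_mul_tperm (lift_perm ord0 ord0 s) ord0 (lift ord0 i).
rewrite /= porbit_sym porbits_lift_perm.
rewrite (_ : _ \notin _) /= ?addn2 ?addn1; first by case=> ->.
apply/porbitP => -[m]; rewrite lift_permX lift_perm_id => /eqP.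
by rewrite eq_sym (negPf (neq_lift _ _)).
Qed.

Lemma stirling1_n0 n : stirling1 n.+1 0 = 0%N.
Proof.
apply/eqP; rewrite cards_eq0; apply/eqP/setP => s; rewrite !inE cards_eq0.
by apply/eqP => /setP/(_ (porbit s ord0)); rewrite inE imset_f.
Qed.

Lemma stirling1_0n j : stirling1 0 j = (j == 0%N).
Proof.
have p0 (s : 'S_0) : #|porbits s| = 0%N.
  by apply/eqP; rewrite cards_eq0; apply/eqP/setP => A; rewrite inE;
     apply/imsetP => -[[]].
case: j => [|j] /=; rewrite /stirling1.
  rewrite (_ : [set _ | _] = [set: 'S_0]); last by apply/setP => s; rewrite !inE p0.
  by rewrite cardsT card_Sn.
by apply: eq_card0 => s; rewrite inE p0.
Qed.

End Stirling1.

Lemma stirling1_small n j : (n < j)%N -> stirling1 n j = 0%N.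
Proof.
elim: n j => [|n IH] [|j] //; first by rewrite stirling1_0n.
by rewrite ltnS => nj; rewrite stirling1_rec !IH ?muln0 // ltnW.
Qed.

Section Stirling2.
Context (T : finType).
Implicit Types (D E B : {set T}) (Q : {set {set T}}).

(** Partitions of all subsets D of T are needed, since the recurrence below
    deletes blocks that are not initial segments. *)
Definition set_partitions D k := [set Q | partition Q D & #|Q| == k].

Lemma card_partitions_block E B k : B \subset E -> B != set0 ->
  #|set_partitions (E :\: B) k| =
  #|[set Q in set_partitions E k.+1 | B \in Q]|.
Proof.
move=> BE B0.
have notin Q' : partition Q' (E :\: B) -> B \notin Q'.
  move=> /partitionS pQ; apply: contra B0 => /pQ.
  by rewrite subsetD -setI_eq0 setIid => /andP[].
rewrite -(card_in_imset (f := fun Q' => B |: Q')); last first.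
  move=> Q1 Q2; rewrite !inE => /andP[/notin n1 _] /andP[/notin n2 _] eqQ.
  by rewrite -(setU1K n1) eqQ setU1K.
apply/eq_card => Q; rewrite inE; apply/imsetP/andP => [[Q' + ->]|].
  rewrite !inE => /andP[pQ' /eqP cQ']; rewrite eqxx cardsU1 notin // cQ' eqxx andbT.
  rewrite -{1}(setID E B) (setIidPr BE) partitionU1 //.
  by rewrite -setI_eq0 setIDA setIC -setIDA setDv setI0.
case; rewrite inE => /andP[pQ /eqP cQ] BQ; exists (Q :\ B); last by rewrite setD1K.
by rewrite inE partitionD1 // (cardsD1 B) BQ add1n in cQ *; case: cQ => ->; rewrite eqxx.
Qed.

(** Double counting: a partition of E with a marked block B amounts to B and a
    partition of the rest. *)
Lemma sum_partitions_block E k (p : pred {set T}) :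
  (\sum_(B : {set T} | [&& B \subset E, B != set0 & p B])
      #|set_partitions (E :\: B) k|
   = \sum_(Q in set_partitions E k.+1) #|[set B in Q | p B]|)%N.
Proof.
transitivity (\sum_(B : {set T} | [&& B \subset E, B != set0 & p B])
    \sum_(Q in [set Q in set_partitions E k.+1 | B \in Q]) 1)%N.
  apply: eq_bigr => B /and3P[BE B0 _].
  by rewrite card_partitions_block // sum1_card.
under [RHS]eq_bigr do rewrite -sum1_card.
rewrite (exchange_big_dep (mem (set_partitions E k.+1))) /=; last first.
  by move=> B Q _; rewrite inE => /andP[].
apply: eq_bigr => Q; rewrite inE => /andP[pQ cQ]; apply: eq_bigl => B.
rewrite !inE pQ cQ /=; case BQ: (B \in Q); rewrite ?andbF //= andbT.
by rewrite (partitionS pQ BQ) (partition_neq0 pQ BQ).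
Qed.

(** Mark the block of x and delete it. The block {x} leaves a partition of D;
    any other one, deprived of x, marks one of the k+1 blocks of a partition
    of D. *)
Lemma card_set_partitions_rec D x k : x \notin D ->
  #|set_partitions (x |: D) k.+1| =
  (k.+1 * #|set_partitions D k.+1| + #|set_partitions D k|)%N.
Proof.
move=> xD.
have := sum_partitions_block (x |: D) k (fun B => x \in B).
have -> : (\sum_(Q in set_partitions (x |: D) k.+1) #|[set B in Q | x \in B]|
    = #|set_partitions (x |: D) k.+1|)%N.
  rewrite -sum1_card; apply: eq_bigr => Q; rewrite inE => /andP[pQ _].
  have covx : x \in cover Q by rewrite (cover_partition pQ) setU11.
  apply/eqP/cards1P; exists (pblock Q x); apply/setP => B; rewrite !inE.
  apply/andP/eqP => [[BQ xB]|->]; last by rewrite pblock_mem ?mem_pblock.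
  by rewrite (def_pblock (partition_trivIset pQ) BQ).
move=> <-.
rewrite -sum1_card big_distrr /=.
have -> : (\sum_(Q in set_partitions D k.+1) k.+1 * 1)%N
    = (\sum_(Q in set_partitions D k.+1) #|[set B in Q | true]|)%N.
  apply: eq_bigr => Q; rewrite inE => /andP[_ /eqP cQ].
  by rewrite muln1 -cQ; apply: eq_card => B; rewrite inE andbT.
rewrite -(sum_partitions_block D k xpredT).
rewrite (reindex_onto (fun B => x |: B) (fun B => B :\ x)) /=; last first.
  by move=> B /and3P[_ _ xB]; rewrite setD1K.
rewrite (bigD1 set0) /=; last first.
  rewrite setU0 sub1set setU11 set11 setDv eqxx ?andbT /=.
  by apply/set0Pn; exists x; rewrite set11.
rewrite setU0 setU1K // addnC; congr addn.
apply: eq_big => B.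
  rewrite setU11 !andbT.
  have -> : x |: B != set0 by apply/set0Pn; exists x; rewrite setU11.
  case xB: (x \in B).
    have -> : ((x |: B) :\ x == B) = false.
      by apply/eqP => /setP/(_ x); rewrite !inE eqxx xB.
    have -> : (B \subset D) = false by apply: contraNF xD => /subsetP; apply.
    by rewrite andbF.
  rewrite setU1K ?xB // eqxx andbT; congr andb.
  by rewrite subUset sub1set setU11 /= -[D in RHS](setU1K xD) subsetD1 xB andbT.
move=> /andP[/andP[/and3P[_ _ _] /eqP eB] _].
have xB : x \notin B by rewrite -eB !inE eqxx.
congr #|pred_of_set (set_partitions _ _)|; apply/setP => y; rewrite !inE.
by case: eqP => [->|] //=; rewrite (negPf xD) andbF.
Qed.

End Stirling2.

Fixpoint stirling2_rec n k : nat :=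
  match n, k with
  | 0, 0 => 1
  | 0, _.+1 => 0
  | _.+1, 0 => 0
  | n'.+1, k'.+1 => k'.+1 * stirling2_rec n' k'.+1 + stirling2_rec n' k'
  end.

Lemma card_set_partitions (T : finType) (D : {set T}) k :
  #|set_partitions D k| = stirling2_rec #|D| k.
Proof.
move: {2}#|D| (erefl #|D|) => n; elim: n D k => [|n IH] D k cD.
  move/eqP: cD; rewrite cards_eq0 => /eqP ->; rewrite cards0.
  case: k => [|k] /=.
    rewrite (_ : set_partitions _ _ = [set set0]) ?cards1 //.
    apply/setP => Q; rewrite !inE partition_set0.
    by case: eqP => // ->; rewrite cards0.
  rewrite (_ : set_partitions _ _ = set0) ?cards0 //.
  apply/setP => Q; rewrite !inE partition_set0.
  by case: eqP => // ->; rewrite cards0.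
have [x xD] : exists x, x \in D by apply/set0Pn; rewrite -card_gt0 cD.
case: k => [|k].
  rewrite cD /=; apply: eq_card0 => Q; rewrite !inE cards_eq0.
  apply/negP => /andP[/cover_partition + /eqP Q0].
  by rewrite Q0 /cover big_set0 => /setP/(_ x); rewrite inE xD.
have cDx : #|D :\ x| = n by move: cD; rewrite (cardsD1 x) xD => -[].
rewrite -{1}(setD1K xD) card_set_partitions_rec ?setD11 //.
by rewrite !IH // cDx cD.
Qed.

Lemma stirling2E n k : stirling2 n k = stirling2_rec n k.
Proof. by rewrite -[in RHS](card_ord n) -cardsT -card_set_partitions. Qed.

Lemma stirling2_small n k : (n < k)%N -> stirling2 n k = 0%N.
Proof.
rewrite stirling2E; elim: n k => [|n IH] [|k] //=; rewrite ltnS => nk.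
by rewrite !IH ?muln0 // ltnW.
Qed.

From mathcomp Require Import ring lra.
From mathcomp Require Import all_classical all_reals all_analysis.
From mathcomp Require Import measurable_realfun.

Import Order.TTheory GRing.Theory Num.Theory.
Import numFieldNormedType.Exports.

Local Open Scope classical_set_scope.
Local Open Scope ring_scope.

(* Closes the side conditions of field from linear bounds in the context. *)
Ltac nonzero := repeat (apply/andP; split); apply: lt0r_neq0; lra.

(** * The normal distribution function and the heat equation *)

Section MeanValue.
Context {R : realType}.
Implicit Types (f : R -> R) (x y a M : R).

Lemma is_derive_continuous f x (df : R) : is_derive x 1 f df ->
  {for x, continuous f}.
Proof. by move=> [d _]; exact/differentiable_continuous/derivable1_diffP. Qed.

Lemma is_derive_affine x y a : is_derive x 1 (fun z : R => (z - y) * a) a.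
Proof.
have -> : (fun z : R => (z - y) * a) = (id - cst y) * cst a by [].
apply: is_derive_eq; rewrite /GRing.scale /=; ring.
Qed.

Lemma is_derive_lipschitz f (df : R -> R) x y M :
  (forall z, Num.min x y <= z <= Num.max x y ->
     is_derive z 1 f (df z) /\ `|df z| <= M) ->
  `|f y - f x| <= M * `|y - x|.
Proof.
wlog xy : x y / x <= y => [wl|] H.
  have [xy|/ltW yx] := leP x y; first exact: wl.
  by rewrite distrC [`|y - x|]distrC; apply: wl => // z; rewrite minC maxC; exact: H.
rewrite (min_l xy) (max_r xy) in H.
have [||z + ->] := @MVT_segment R f df x y xy.
- by move=> z /itvP zxy; apply: (H z _).1; rewrite !ltW ?zxy.
- apply: continuous_in_subspaceT => z; rewrite inE /= in_itv /= => /H[dz _].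
  exact: is_derive_continuous dz.
by rewrite in_itv /= => /H[_ hM]; rewrite normrM ler_wpM2r.
Qed.

(** The mean value inequality is used twice, which gives the factor 1 instead
    of 1/2. *)
Lemma taylor2 f (f1 f2 : R -> R) M x a :
  (forall z, Num.min x (x + a) <= z <= Num.max x (x + a) ->
    [/\ is_derive z 1 f (f1 z), is_derive z 1 f1 (f2 z) & `|f2 z| <= M]) ->
  `|f (x + a) - f x - a * f1 x| <= M * a ^+ 2.
Proof.
move=> H.
pose g z := f z - (z - x) * f1 x.
have -> : f (x + a) - f x - a * f1 x = g (x + a) - g x by rewrite /g; ring.
have -> : M * a ^+ 2 = M * `|a| * `|x + a - x|.
  by rewrite addrAC subrr add0r -mulrA -normrM ger0_norm // -expr2 sqr_ge0.
apply: (is_derive_lipschitz (df := fun z => f1 z - f1 x)) => z zx; split.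
  have [d1 _ _] := H z zx.
  have -> : g = f - (fun z => (z - x) * f1 x) by [].
  by apply: is_deriveB; exact: is_derive_affine.
apply: (le_trans (is_derive_lipschitz (df := f2) (M := M) _)).
  move=> u ux; have [|_ ? ?] := H u => //.
  case/andP: zx => z1 z2; case/andP: ux => u1 u2; apply/andP; split.
    by apply: le_trans u1; rewrite le_min ge_min lexx.
  by apply: (le_trans u2); rewrite ge_max le_max lexx.
have M0 : 0 <= M by have [_ _] := H z zx; apply: le_trans.
apply: ler_wpM2l => //.
move: zx; have [a0|a0] := leP 0 a.
  rewrite min_l ?max_r ?lerDl // => /andP[? ?]; rewrite !ger0_norm; lra.
have a1 := ltW a0; rewrite min_r ?max_l ?gerDl // => /andP[? ?]; rewrite !ler0_norm; lra.
Qed.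

End MeanValue.

Section NormalCdf.
Context {R : realType}.
Implicit Types (s x y w a c : R).
Local Notation mu := (@lebesgue_measure R).

Definition normal_cdf s x : R := fine (normal_prob 0 s `]-oo, x]%classic).

Lemma normal_probE s x :
  normal_prob 0 s `]-oo, x]%classic = (normal_cdf s x)%:E.
Proof. by rewrite fineK // fin_num_measure. Qed.

Lemma normal_cdf_ge0 s x : 0 <= normal_cdf s x.
Proof. by rewrite fine_ge0. Qed.

Lemma normal_cdf_le1 s x : normal_cdf s x <= 1.
Proof. by rewrite -lee_fin -normal_probE probability_le1. Qed.

Lemma normal_cdf_nd s x y : x <= y -> normal_cdf s x <= normal_cdf s y.
Proof.
move=> xy; rewrite -lee_fin -!normal_probE le_measure ?inE //.
exact: subitvPr.
Qed.

Let idR : measurableTypeR R -> R := idfun.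

#[local] HB.instance Definition _ :=
  @isMeasurableFun.Build _ _ _ _ idR (@measurable_id _ _ setT).

Lemma cvg_normal_cdfy s : normal_cdf s x @[x --> +oo] --> (1 : R).
Proof. exact: fine_cvg (@cvg_cdfy1 _ _ R (normal_prob 0 s) idR). Qed.

Lemma cvg_normal_cdfNy s : normal_cdf s x @[x --> -oo] --> (0 : R).
Proof. exact: fine_cvg (@cvg_cdfNy0 _ _ R (normal_prob 0 s) idR). Qed.

Lemma is_derive_normal_cdf s x : s != 0 ->
  is_derive x 1 (normal_cdf s) (normal_pdf 0 s x).
Proof.
move=> s0.
have int : mu.-integrable [set` Interval -oo%O (BRight (x + 1))]
    (EFin \o normal_pdf 0 s).
  apply: (integrableS measurableT) => //; exact: integrable_normal_pdf.
have x1 : x < x + 1 by rewrite ltrDl.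
have [dF F'] := continuous_FTC1 x1 int (ltNyr _) (@continuous_normal_pdf R 0 s s0 x).
rewrite derive1E in F'; exact: DeriveDef dF F'.
Qed.

Definition gauss x : R := normal_pdf 0 1 x.

Lemma gaussE x : gauss x = normal_peak 1 * expR (- (x ^+ 2 / 2)).
Proof.
rewrite /gauss normal_pdfE // /normal_fun subr0 expr1n mulNr.
by rewrite -mulr_natl mulr1.
Qed.

Lemma normal_pdf_scale s x : 0 < s -> normal_pdf 0 s x = s^-1 * gauss (x / s).
Proof.
move=> s0; rewrite gaussE normal_pdfE ?gt_eqF // /normal_peak /normal_fun.
rewrite mulrA; congr (_ * expR _).
  rewrite expr1n mul1r -mulrnAr sqrtrM ?sqr_ge0 // sqrtr_sqr gtr0_norm //.
  by rewrite invfM.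
by rewrite subr0 -mulr_natl; field; rewrite gt_eqF.
Qed.

(** Both sides have the same derivative and the same limit at infinity. *)
Lemma normal_cdf_scale s x : 0 < s -> normal_cdf s x = normal_cdf 1 (x / s).
Proof.
move=> s0; pose G y := normal_cdf s y - normal_cdf 1 (y / s).
have dG y : is_derive y 1 G 0.
  have d1 := @is_derive_normal_cdf s y (lt0r_neq0 s0).
  have d2 := @is_derive_normal_cdf 1 (y / s) (oner_neq0 _).
  have d3 : is_derive y 1 (fun z : R => z / s) s^-1.
    have -> : (fun z : R => z / s) = (fun z => (z - 0) * s^-1).
      by apply/funext => z; rewrite subr0.
    exact: is_derive_affine.
  have -> : G = normal_cdf s - (normal_cdf 1 \o (fun z => z / s)) by [].
  apply: (is_derive_eq (is_deriveB d1 (@is_derive1_comp R (normal_cdf 1) (fun z => z / s) y _ _ d2 d3))).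
  by rewrite normal_pdf_scale // [s^-1 * _]mulrC subrr.
have cG : G y @[y --> +oo] --> (0 : R).
  rewrite -(subrr (1 : R)); apply: cvgB; first exact: cvg_normal_cdfy.
  apply: (cvg_comp (fun y : R => y / s)); last exact: cvg_normal_cdfy.
  by apply: gt0_cvgMly => //; rewrite invr_gt0.
have : G x = 0.
  have Gc : G = cst (G x) by apply/funext => y; exact: is_derive_0_is_cst.
  have : G y @[y --> +oo] --> G x by rewrite {1}Gc; exact: cvg_cst.
  by move=> /cvg_unique; apply.
by move=> /eqP; rewrite subr_eq0 => /eqP.
Qed.

End NormalCdf.

Section Heat.
Context {R : realType}.
Implicit Types (x y w a c : R).
Local Notation gauss := (@gauss R).
Local Notation Phi := (@normal_cdf R 1).

Lemma taylor3 (f f1 f2 f3 : R -> R) (M x a : R) :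
  (forall z : R, [/\ is_derive z 1 f (f1 z), is_derive z 1 f1 (f2 z),
     is_derive z 1 f2 (f3 z) & `|f3 z| <= M]) ->
  `|f (x + a) - f x - a * f1 x - a ^+ 2 * (f2 x / 2)| <= M * `|a| ^+ 3.
Proof.
move=> H.
have M0 : 0 <= M by have [_ _ _] := H 0; apply: le_trans.
pose g z := f z - ((z - x) * f1 x + (z - x) ^+ 2 * (f2 x / 2)).
have -> : f (x + a) - f x - a * f1 x - a ^+ 2 * (f2 x / 2) = g (x + a) - g x.
  by rewrite /g; ring.
have -> : M * `|a| ^+ 3 = M * `|a| ^+ 2 * `|x + a - x|.
  by rewrite addrAC subrr add0r; ring.
apply: (is_derive_lipschitz (df := fun z => f1 z - f1 x - (z - x) * f2 x)) => z zx; split.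
  have [d1 _ _ _] := H z.
  have -> : g = f - ((fun z => (z - x) * f1 x) + (fun z => (z - x) * 1) ^+ 2 * cst (f2 x / 2)).
    by apply/funext => u; rewrite /g !fctE mulr1.
  have d2 := is_derive_affine z x (f1 x); have d3 := is_derive_affine z x 1.
  apply: (is_derive_eq (is_deriveB d1 (is_deriveD d2
    (is_deriveM (is_deriveX 2 d3) (is_derive_cst (f2 x / 2) z 1))))).
  by rewrite /GRing.scale /= fctE; field.
have := @taylor2 R f1 f2 f3 M x (z - x); rewrite addrC subrK.
move=> /(_ _)/le_trans; apply.
  by move=> u _; have [] := H u.
apply: ler_wpM2l => //; rewrite -[(z - x) ^+ 2]real_normK ?num_real //.
rewrite ler_sqr ?nnegrE //.
move: zx; have [a0|a0] := leP 0 a.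
  rewrite min_l ?max_r ?lerDl // => /andP[? ?]; rewrite !ger0_norm; lra.
have a1 := ltW a0; rewrite min_r ?max_l ?gerDl // => /andP[? ?]; rewrite !ler0_norm; lra.
Qed.

Lemma gauss_ge0 y : 0 <= gauss y.
Proof. exact: normal_pdf_ge0. Qed.

(** With t = y^2 / 4, the bound follows from 1 + y^4 <= 16 (1 + t)^2 and
    (1 + t)^2 <= exp (2t). The derivatives needed below are the normal density
    times polynomials dominated by 1 + y^4. *)
Lemma gauss_decay y : (1 + y ^+ 4) * gauss y <= 16.
Proof.
rewrite gaussE.
have p1 : normal_peak 1 <= 1 :> R.
  rewrite /normal_peak expr1n mul1r invf_le1; last first.
    by rewrite sqrtr_gt0 mulrn_wgt0 // pi_gt0.
  rewrite -[leLHS]sqrtr1 ler_sqrt; last by rewrite mulrn_wge0 // pi_ge0.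
  by have := pi_ge2 R; rewrite mulr2n; lra.
have p0 : 0 <= normal_peak 1 :> R by exact: normal_peak_ge0.
have e4 : 1 + y ^+ 2 / 4 <= expR (y ^+ 2 / 4) by exact: expR_ge1Dx.
have e2 : expR (y ^+ 2 / 2) = expR (y ^+ 2 / 4) ^+ 2.
  by rewrite -expRM_natl; congr expR; rewrite mulr_natl mulr2n; field.
have y2 : 0 <= y ^+ 2 by exact: sqr_ge0.
have h : (1 + y ^+ 4) <= 16 * expR (y ^+ 2 / 2).
  rewrite e2.
  have : (1 + y ^+ 2 / 4) ^+ 2 <= expR (y ^+ 2 / 4) ^+ 2.
    by rewrite ler_sqr ?nnegrE ?expR_ge0 //; lra.
  have -> : (1 + y ^+ 2 / 4) ^+ 2 = 1 + y ^+ 2 / 2 + y ^+ 4 / 16 by field.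
  lra.
rewrite expRN mulrA ler_pdivrMr ?expR_gt0 //.
have y4 : 0 <= 1 + y ^+ 4.
  by rewrite (_ : y ^+ 4 = (y ^+ 2) ^+ 2) -?exprM // exprM; have := sqr_ge0 (y ^+ 2); lra.
apply: le_trans h.
by rewrite -[leRHS]mulr1 ler_wpM2l.
Qed.

Lemma gauss_poly_bound (p y : R) : `|p| <= 1 + y ^+ 4 -> `|p * gauss y| <= 16.
Proof.
move=> h; rewrite normrM (ger0_norm (gauss_ge0 y)).
by apply: le_trans (gauss_decay y); rewrite ler_wpM2r // gauss_ge0.
Qed.

Lemma is_derive_gauss y : is_derive y 1 gauss (- y * gauss y).
Proof.
have e : gauss = cst (normal_peak 1) * (expR \o (- ((id ^+ 2) * cst (2^-1)))).
  by apply/funext => u; rewrite gaussE !fctE.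
rewrite [X in is_derive _ _ X]e; apply: is_derive_eq.
by rewrite /GRing.scale /= gaussE !fctE; field.
Qed.

Definition gauss1 y := - y * gauss y.
Definition gauss2 y := (y ^+ 2 - 1) * gauss y.

Lemma is_derive_gauss1 y : is_derive y 1 gauss1 (gauss2 y).
Proof.
have -> : gauss1 = - id * gauss by [].
have d := is_derive_gauss y.
apply: is_derive_eq; rewrite /GRing.scale /gauss2 /= !fctE; ring.
Qed.

Lemma gauss2_bound y : `|gauss2 y| <= 16.
Proof.
apply: gauss_poly_bound.
have y2 := sqr_ge0 y; have y4 := sqr_ge0 (y ^+ 2 - 1); have y5 := sqr_ge0 (y ^+ 2).
have e : y ^+ 4 = (y ^+ 2) ^+ 2 by rewrite -exprM.
by rewrite e ler_norml; apply/andP; split; lra.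
Qed.

Lemma normal_cdf_taylor3 y a :
  `|Phi (y + a) - Phi y - a * gauss y - a ^+ 2 * (gauss1 y / 2)| <= 16 * `|a| ^+ 3.
Proof.
apply: (taylor3 (f3 := gauss2)) => z; split.
- exact: is_derive_normal_cdf.
- exact: is_derive_gauss.
- exact: is_derive_gauss1.
- exact: gauss2_bound.
Qed.

Definition heat w x : R := Phi (x / Num.sqrt w).
(** The heat equation: this is both the derivative of heat in w and half its
    second derivative in x. *)
Definition heat_w w x : R := gauss1 (x / Num.sqrt w) / 2 / w.

Lemma is_derive_div_sqrt x w : 0 < w ->
  is_derive w 1 (fun z => x / Num.sqrt z) (- (x / Num.sqrt w / (2 * w))).
Proof.
move=> w0; have s0 : 0 < Num.sqrt w by rewrite sqrtr_gt0.
have d := is_derive1_sqrt w0.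
have d2 := @is_deriveV R Num.sqrt w _ 1 (lt0r_neq0 s0) d.
have -> : (fun z => x / Num.sqrt z) = cst x * (fun z => (Num.sqrt z)^-1) by [].
apply: (is_derive_eq (is_deriveM (is_derive_cst x w 1) d2)).
have -> : 2 * w = 2 * Num.sqrt w ^+ 2 by rewrite sqr_sqrtr // ltW.
by rewrite /GRing.scale /= mulr0 addr0; field; rewrite gt_eqF.
Qed.

Lemma is_derive_heat x w : 0 < w ->
  is_derive w 1 (fun z => heat z x) (heat_w w x).
Proof.
move=> w0; have d := is_derive_div_sqrt x w0.
have dp := @is_derive_normal_cdf R 1 (x / Num.sqrt w) (oner_neq0 _).
apply: (is_derive_eq (@is_derive1_comp R Phi (fun z => x / Num.sqrt z) w _ _ dp d)).
have s0 : 0 < Num.sqrt w by rewrite sqrtr_gt0.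
rewrite -/(gauss _) /heat_w /gauss1; field; nonzero.
Qed.

Lemma is_derive_heat_w x w : 0 < w ->
  is_derive w 1 (fun z => heat_w z x)
    ((3 * (x / Num.sqrt w) - (x / Num.sqrt w) ^+ 3) / 4 * gauss (x / Num.sqrt w) / w ^+ 2).
Proof.
move=> w0; have d := is_derive_div_sqrt x w0.
have d1 := @is_derive1_comp R gauss1 (fun z => x / Num.sqrt z) w _ _
  (is_derive_gauss1 (x / Num.sqrt w)) d.
have d2 := @is_deriveV R id w _ 1 (lt0r_neq0 w0) (is_derive_id w 1).
have -> : (fun z => heat_w z x) =
   (gauss1 \o (fun z => x / Num.sqrt z)) * cst (2^-1) * (fun z => z^-1) by [].
apply: (is_derive_eq (is_deriveM (is_deriveM d1 (is_derive_cst (2^-1 : R) w 1)) d2)).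
have s0 : 0 < Num.sqrt w by rewrite sqrtr_gt0.
rewrite /GRing.scale /= !fctE /gauss1 /gauss2; field; nonzero.
Qed.

(** The normal distribution function with variance w solves the heat equation:
    a shift by a and a change of variance by c compensate each other to second
    order as soon as a and a^2 + c average to zero. *)
Lemma heat_step w0 w x a c : 0 < w0 <= 1 -> w0 <= w -> w0 <= w + c ->
  `|heat (w + c) (x + a) - heat w x - a * (gauss (x / Num.sqrt w) / Num.sqrt w)
     - (a ^+ 2 + c) * heat_w w x| <=
  16 / w0 ^+ 2 * (`|a| ^+ 3 + `|a| * `|c| + c ^+ 2).
Proof.
move=> /andP[w00 w01] hw hc.
have wp : 0 < w by lra.
set s := Num.sqrt w; have s0 : 0 < s by rewrite sqrtr_gt0.
have ss : s ^+ 2 = w by rewrite sqr_sqrtr // ltW.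
set I := w0^-1; have I1 : 1 <= I by rewrite invf_ge1.
have i1 : s^-1 <= I.
  rewrite lef_pV2 ?posrE //; apply: (@le_trans _ _ (Num.sqrt w0)).
    rewrite -{1}(sqr_sqrtr (ltW w00)) expr2 -[X in _ <= X]mulr1.
    by apply: ler_wpM2l; rewrite ?sqrtr_ge0 // -[X in _ <= X]sqrtr1 ler_sqrt.
  by rewrite ler_sqrt // ltW.
have i2 : w^-1 <= I by rewrite lef_pV2.
have is0 : 0 <= s^-1 by rewrite invr_ge0 ltW.
have iw0 : 0 <= w^-1 by rewrite invr_ge0 ltW.
have i3 : w^-1 * s^-1 <= I ^+ 2 by rewrite expr2; apply: ler_pM.
have T1 : `|heat (w + c) (x + a) - heat w (x + a) - c * heat_w w (x + a)|
    <= 16 * I ^+ 2 * c ^+ 2.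
  apply: (taylor2 (f := fun z => heat z (x + a)) (f1 := fun z => heat_w z (x + a))).
  move=> z; rewrite ge_min => /andP[hz _].
  have hz' : w0 <= z by case/orP: hz => h; [exact: le_trans h|exact: le_trans h].
  have z0 : 0 < z by lra.
  split; [exact: is_derive_heat|exact: is_derive_heat_w|].
  rewrite normrM; apply: ler_pM => //.
    apply: gauss_poly_bound; set y := (x + a) / Num.sqrt z.
    have y2 := sqr_ge0 (y ^+ 2 - 1); have y4 := sqr_ge0 (y ^+ 2).
    have y5 := sqr_ge0 (y - 1); have y6 := sqr_ge0 (y + 1).
    have y7 := sqr_ge0 (y * (y - 1)); have y8 := sqr_ge0 (y * (y + 1)).
    rewrite !expr2 in y2 y4 y5 y6 y7 y8.
    by rewrite ler_norml; apply/andP; split; lra.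
  rewrite ger0_norm; last by rewrite invr_ge0 sqr_ge0.
  rewrite -exprVn ler_sqr ?nnegrE ?invr_ge0 ?(ltW z0) ?(ltW w00) //.
  by rewrite lef_pV2.
have T2 : `|heat_w w (x + a) - heat_w w x| <= 16 * I ^+ 2 * `|a|.
  have -> : heat_w w (x + a) - heat_w w x =
      (gauss1 ((x + a) / s) - gauss1 (x / s)) / 2 / w by rewrite /heat_w -/s; ring.
  have h : `|gauss1 ((x + a) / s) - gauss1 (x / s)| <= 16 * `|(x + a) / s - x / s|.
    apply: (is_derive_lipschitz (df := gauss2)) => z _; split.
      exact: is_derive_gauss1.
    exact: gauss2_bound.
  have e : (x + a) / s - x / s = a / s by ring.
  rewrite e normrM [ `|s^-1|]ger0_norm // in h.
  rewrite 2!normrM (ger0_norm iw0) [ `|2^-1|]ger0_norm ?invr_ge0 //.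
  apply: (@le_trans _ _ (16 * (`|a| / s) / w)).
    apply: ler_wpM2r => //; apply: le_trans h.
    by rewrite ler_piMr // invf_le1 // ler1n.
  have -> : 16 * (`|a| / s) / w = 16 * (w^-1 * s^-1) * `|a| by ring.
  by rewrite ler_wpM2r // ler_wpM2l.
have T3 : `|heat w (x + a) - heat w x - a * (gauss (x / s) / s) - a ^+ 2 * heat_w w x|
    <= 16 * I ^+ 2 * `|a| ^+ 3.
  have := normal_cdf_taylor3 (x / s) (a / s).
  have -> : x / s + a / s = (x + a) / s by ring.
  have -> : a / s * gauss (x / s) = a * (gauss (x / s) / s) by ring.
  have -> : (a / s) ^+ 2 * (gauss1 (x / s) / 2) = a ^+ 2 * heat_w w x.
    by rewrite /heat_w -/s -ss; field; rewrite gt_eqF.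
  move/le_trans; apply; rewrite normrM [ `|s^-1|]ger0_norm // exprMn.
  have -> : s^-1 ^+ 3 = w^-1 * s^-1 by rewrite -ss; field; rewrite gt_eqF.
  have -> : 16 * (`|a| ^+ 3 * (w^-1 * s^-1)) = 16 * (w^-1 * s^-1) * `|a| ^+ 3 by ring.
  by rewrite ler_wpM2r ?exprn_ge0 // ler_wpM2l.
have -> : heat (w + c) (x + a) - heat w x - a * (gauss (x / s) / s)
     - (a ^+ 2 + c) * heat_w w x =
  (heat w (x + a) - heat w x - a * (gauss (x / s) / s) - a ^+ 2 * heat_w w x)
  + c * (heat_w w (x + a) - heat_w w x)
  + (heat (w + c) (x + a) - heat w (x + a) - c * heat_w w (x + a)) by ring.
have T2' : `|c * (heat_w w (x + a) - heat_w w x)| <= 16 * I ^+ 2 * (`|a| * `|c|).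
  rewrite normrM mulrC [leRHS]mulrA; exact: ler_wpM2r.
apply: (le_trans (ler_normD _ _)); apply: (le_trans (lerD (ler_normD _ _) (lexx _))).
apply: (le_trans (lerD (lerD T3 T2') T1)).
by rewrite -exprVn -/I -!mulrDr.
Qed.

End Heat.

(** * The Lah distribution as a Markov chain *)

Section LahNumbers.
Context {R : realType}.
Implicit Types (F G : nat -> R) (n k : nat) (a : R).

(** The expectation under the Lah law before normalization; unlike the law it
    satisfies a recursion that needs no knowledge of the Lah numbers. *)
Definition lah_sum n k F : R :=
  \sum_(j < n.+1) (stirling1 n j * stirling2 j k)%:R * F j.

Lemma lah_sum_rec n k F :
  lah_sum n.+1 k.+1 F = n%:R * lah_sum n k.+1 F
    + k.+1%:R * lah_sum n k.+1 (F \o succn) + lah_sum n k (F \o succn).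
Proof.
have wide G : lah_sum n k.+1 G =
    \sum_(j < n.+1) (stirling1 n j.+1 * stirling2 j.+1 k.+1)%:R * G j.+1.
  transitivity (\sum_(j < n.+2) (stirling1 n j * stirling2 j k.+1)%:R * G j).
    by rewrite [RHS]big_ord_recr /= stirling1_small // mul0n mul0r addr0.
  by rewrite big_ord_recl /= stirling2E muln0 mul0r add0r.
rewrite (wide F) /lah_sum [LHS]big_ord_recl /= stirling2E muln0 mul0r add0r.
rewrite !mulr_sumr -!big_split /=; apply: eq_bigr => i _.
rewrite /bump /= !add1n stirling1_rec !stirling2E /= -!stirling2E.
by rewrite !(natrM, natrD); ring.
Qed.

Lemma lah_sum_n0 n F : lah_sum n.+1 0 F = 0.
Proof.
rewrite /lah_sum big1 // => -[[|j] ?] _ /=; first by rewrite stirling1_n0 mul0r.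
by rewrite stirling2E /= muln0 mul0r.
Qed.

Lemma lah_sum_small n k F : (n < k)%N -> lah_sum n k F = 0.
Proof.
move=> nk; rewrite /lah_sum big1 // => -[j /= jn] _.
by rewrite stirling2_small ?muln0 ?mul0r // (leq_trans jn).
Qed.

Lemma natr_lah n k : (lah n k)%:R = lah_sum n k (fun=> 1).
Proof.
have [kn|nk] := leqP k n.+1; last first.
  by rewrite lah_sum_small 1?ltnW // /lah big_geq // ltnW.
rewrite /lah natr_sum /lah_sum.
rewrite -(big_mkord xpredT (fun j => (stirling1 n j * stirling2 j k)%:R * 1)).
rewrite [RHS](big_cat_nat (n := k)) //= [X in _ = X + _]big1_seq ?add0r.
  by apply: eq_bigr => j _; rewrite mulr1.
by move=> j; rewrite mem_index_iota /= => jk; rewrite stirling2_small // muln0 mul0r.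
Qed.

Lemma lah_closed_form n k :
  lah_sum n.+1 k.+1 (fun=> 1) = (n.+1)`!%:R * 'C(n, k)%:R / (k.+1)`!%:R.
Proof.
elim: n k => [|n IH] k.
  rewrite lah_sum_rec /= mul0r add0r /comp /lah_sum !big_ord1.
  rewrite !stirling1_0n !stirling2E /= mul0r mulr0 add0r mulr1 mul1n.
  case: k => [|k] /=; last by rewrite bin0n /= mulr0 mul0r.
  by rewrite !factS fact0 bin0 mulr1 divr1.
have kf i : i`!%:R != 0 :> R by rewrite pnatr_eq0 -lt0n fact_gt0.
rewrite lah_sum_rec /comp IH.
case: k => [|k].
  by rewrite lah_sum_n0 !bin0 addr0 !factS fact0 !natrM; field.
rewrite IH binS (factS n.+1) (factS k.+1).
have k1 : k.+2%:R != 0 :> R by rewrite pnatr_eq0.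
have := kf k.+1; move: ((n.+1)`!) ((k.+1)`!) => f g k2.
have := mul_bin_left n k => /(congr1 (GRing.natmul (1 : R))).
rewrite !natrM natrD.
have [kn|nk] := leqP k n; last first.
  by rewrite !bin_small // ?(leq_trans nk) //= => _; rewrite !(mulr0,mul0r,addr0).
rewrite natrB //; set c := 'C(n, k.+1)%:R; set c' := 'C(n, k)%:R => E.
suff H : (n.+2%:R * (c + c') = (n.+1%:R + k.+2%:R) * c + k.+2%:R * c')%R.
  transitivity (f%:R * ((n.+1%:R + k.+2%:R) * c + k.+2%:R * c')
     / (k.+2%:R * g%:R)).
    by field; rewrite k2 -natrD pnatr_eq0.
  by rewrite -H; field; rewrite k2 -natrD pnatr_eq0.
lra.
Qed.

Definition lah_mean n k F : R := lah_sum n k F / (lah n k)%:R.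

Lemma lah_meanE n k F : lah_mean n k F = \sum_(j < n.+1) lah_pmf R n k j * F j.
Proof.
by rewrite /lah_mean /lah_sum mulr_suml; apply: eq_bigr => j _;
   rewrite /lah_pmf mulrAC.
Qed.

Lemma lah_gt0 n k : (0 < k <= n)%N -> 0 < (lah n k)%:R :> R.
Proof.
case: n k => [|n] [|k] //=; rewrite ltnS => kn.
by rewrite natr_lah lah_closed_form divr_gt0 ?mulr_gt0 // ltr0n ?fact_gt0 ?bin_gt0.
Qed.

(** The last of n+1 points lies in a longer cycle, or is a cycle of its own in
    a block with other cycles, or is a block of its own; these are the three
    terms. Their weights are the coefficients in lah_sum_rec times ratios of
    Lah numbers. *)
Lemma lah_mean_rec n k F : (0 < n)%N -> (0 < k <= n.+1)%N ->
  let q : R := k%:R * (k%:R - 1) / (n.+1%:R * n%:R) in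
  lah_mean n.+1 k F =
    (n.+1%:R - k%:R) / n.+1%:R * lah_mean n k F
    + k%:R * (n.+1%:R - k%:R) / (n.+1%:R * n%:R) * lah_mean n k (F \o succn)
    + q * lah_mean n k.-1 (F \o succn).
Proof.
case: n k => [//|n] [//|k] _ /= kn.
have Lpos : (lah n.+2 k.+1)%:R != 0 :> R by rewrite gt_eqF // lah_gt0.
have n0 : n.+1%:R != 0 :> R by rewrite pnatr_eq0.
have n1 : n.+2%:R != 0 :> R by rewrite pnatr_eq0.
have kf i : i`!%:R != 0 :> R by rewrite pnatr_eq0 -lt0n fact_gt0.
have kf1 := kf k. have k1 : k.+1%:R != 0 :> R by rewrite pnatr_eq0.
have r1 G : n.+2%:R * n.+1%:R * lah_sum n.+1 k.+1 G =
   (n.+2%:R - k.+1%:R) * (lah n.+2 k.+1)%:R * lah_mean n.+1 k.+1 G.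
  have [k0|k0] := leqP k n; last first.
    by rewrite /lah_mean lah_sum_small ?ltnS // mul0r !mulr0.
  have L1 : (lah n.+1 k.+1)%:R != 0 :> R by rewrite gt_eqF // lah_gt0.
  suff -> : (n.+2%:R - k.+1%:R) * (lah n.+2 k.+1)%:R
      = n.+2%:R * n.+1%:R * (lah n.+1 k.+1)%:R :> R.
    by rewrite /lah_mean; field.
  rewrite !natr_lah !lah_closed_form -natrB; last by rewrite ltnS (leq_trans k0).
  rewrite subSS (factS n.+1).
  move: ((n.+1)`!) ((k.+1)`!) => f g.
  have := mul_bin_down n.+1 k => /(congr1 (GRing.natmul (1 : R))).
  rewrite !natrM => E.
  transitivity (n.+2%:R * f%:R * ((n.+1 - k)%:R * 'C(n.+1, k)%:R) / g%:R :> R).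
    by ring.
  by rewrite -E; ring.
have r2 G : n.+2%:R * n.+1%:R * lah_sum n.+1 k G =
   k.+1%:R * k%:R * (lah n.+2 k.+1)%:R * lah_mean n.+1 k G.
  have [->|k0] := posnP k; first by rewrite lah_sum_n0 !(mulr0,mul0r).
  have L1 : (lah n.+1 k)%:R != 0 :> R by rewrite gt_eqF // lah_gt0 // k0.
  suff -> : k.+1%:R * k%:R * (lah n.+2 k.+1)%:R
      = n.+2%:R * n.+1%:R * (lah n.+1 k)%:R :> R.
    by rewrite /lah_mean; field.
  case: k k0 {kn Lpos r1 L1} kf1 k1 => [//|k] _ kf1 k1.
  have k2 : k.+1%:R != 0 :> R by rewrite pnatr_eq0.
  rewrite !natr_lah !lah_closed_form (factS n.+1) (factS k.+1).
  move: ((n.+1)`!) ((k.+1)`!) kf1 => f g kf1.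
  have := mul_bin_diag n.+1 k => /(congr1 (GRing.natmul (1 : R))).
  rewrite !natrM => E.
  transitivity (n.+2%:R * f%:R * (k.+1%:R * 'C(n.+1, k.+1)%:R) / g%:R :> R).
    by field; rewrite kf1 -natrD pnatr_eq0.
  by rewrite -E; ring.
have e1 : k.+1%:R - 1 = k%:R :> R by rewrite -natr1 addrK.
rewrite e1 {1}/lah_mean lah_sum_rec.
apply: (mulIf Lpos); rewrite divfK //.
have n2 : n.+2%:R * n.+1%:R != 0 :> R by rewrite mulf_neq0.
apply: (mulfI n2).
transitivity (n.+1%:R * (n.+2%:R * n.+1%:R * lah_sum n.+1 k.+1 F)
  + k.+1%:R * (n.+2%:R * n.+1%:R * lah_sum n.+1 k.+1 (F \o succn))
  + n.+2%:R * n.+1%:R * lah_sum n.+1 k (F \o succn)); first by ring.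
by rewrite !r1 r2; field; rewrite nat1r -natrD !pnatr_eq0.
Qed.

Lemma eq_lah_mean n k F G : F =1 G -> lah_mean n k F = lah_mean n k G.
Proof. by move=> FG; rewrite !lah_meanE; apply: eq_bigr => j _; rewrite FG. Qed.

Lemma lah_meanD n k F G :
  lah_mean n k (fun j => F j + G j) = lah_mean n k F + lah_mean n k G.
Proof. by rewrite !lah_meanE -big_split; apply: eq_bigr => j _; rewrite mulrDr. Qed.

Lemma lah_meanZ n k (c : R) F : lah_mean n k (fun j => c * F j) = c * lah_mean n k F.
Proof. by rewrite !lah_meanE mulr_sumr; apply: eq_bigr => j _; rewrite mulrCA. Qed.

Lemma lah_mean1 n k : (0 < k <= n)%N -> lah_mean n k (fun=> 1) = 1.
Proof. by move=> kn; rewrite /lah_mean -natr_lah divff // gt_eqF // lah_gt0. Qed.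

Lemma lah_mean0 n k F : (0 < n)%N -> ~~ (0 < k <= n)%N -> lah_mean n k F = 0.
Proof.
case: n k => [//|n] [|k] _ /=; rewrite /lah_mean.
  by rewrite lah_sum_n0 mul0r.
by rewrite -ltnNge => nk; rewrite lah_sum_small ?mul0r.
Qed.

Lemma lah_pmf_ge0 n k j : 0 <= lah_pmf R n k j.
Proof. by rewrite /lah_pmf divr_ge0. Qed.

Lemma ler_lah_mean n k F G : (forall j, F j <= G j) ->
  lah_mean n k F <= lah_mean n k G.
Proof.
by move=> FG; rewrite !lah_meanE; apply: ler_sum => j _; rewrite ler_wpM2l ?lah_pmf_ge0.
Qed.

Lemma lah_mean_11 F : lah_mean 1 1 F = F 1%N.
Proof.
have L11 : (lah 1 1)%:R = 1 :> R.
  by rewrite natr_lah lah_closed_form bin0 mulr1 divff // pnatr_eq0.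
rewrite /lah_mean L11 divr1 lah_sum_rec mul0r add0r /lah_sum !big_ord1.
by rewrite !stirling1_0n !stirling2E /= !mul1r !(mulr0, mul0r, add0r).
Qed.

(** * Mean and variance of the Lah distribution *)

Definition recip_sum k n : R := \sum_(k <= i < n.+1) i%:R^-1.
Definition recip_sqr_sum k n : R := \sum_(k <= i < n.+1) (i%:R ^+ 2)^-1.

Definition lah_avg n k : R := lah_mean n k (fun j => j%:R).
Definition lah_var n k : R :=
  lah_mean n k (fun j => j%:R ^+ 2) - lah_avg n k ^+ 2.

Definition drop_prob n k : R := k%:R * (k%:R - 1) / (n.+1%:R * n%:R).
Definition avg_gap n k : R := lah_avg n k - lah_avg n k.-1.

(** The variance of B - eta C, where B says that the last point is a cycle of
    its own, C that it is a block of its own, and eta is the effect of a drop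
    of k on the mean; the covariance of B and C is q (1 - rho). *)
Definition step_var n k : R :=
  let rho := k%:R / n.+1%:R in
  let q := drop_prob n k in let eta := avg_gap n k in
  rho * (1 - rho) + eta ^+ 2 * q * (1 - q) - 2 * eta * q * (1 - rho).

(** The law of size n is void for k = n + 1, where its coefficient is zero. *)
Lemma stay_mass n k : (0 < n)%N -> (0 < k <= n.+1)%N ->
  (n.+1%:R - k%:R) * lah_mean n k (fun=> 1) = n.+1%:R - k%:R :> R.
Proof.
move=> n0 /andP[k0]; rewrite leq_eqVlt => /predU1P[->|kn].
  by rewrite subrr mul0r.
by rewrite lah_mean1 ?mulr1 // k0.
Qed.

Lemma drop_mass n k : (0 < n)%N -> (0 < k <= n.+1)%N ->
  drop_prob n k * lah_mean n k.-1 (fun=> 1) = drop_prob n k.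
Proof.
case: k => [|[|k]] // n0 /= kn; first by rewrite /drop_prob subrr mulr0 !mul0r.
by rewrite lah_mean1 ?mulr1.
Qed.

Lemma natrS_neq0 n : (n.+1%:R : R) != 0.
Proof. by rewrite pnatr_eq0. Qed.

Lemma lah_avg_rec n k : (0 < n)%N -> (0 < k <= n.+1)%N ->
  lah_avg n.+1 k = lah_avg n k + k%:R / n.+1%:R - drop_prob n k * avg_gap n k.
Proof.
move=> n0 kn; rewrite /lah_avg lah_mean_rec //= -/(drop_prob n k).
have shift i : lah_mean n i ((fun j => j%:R) \o succn)
    = lah_mean n i (fun j => j%:R) + lah_mean n i (fun=> 1) :> R.
  by rewrite -lah_meanD; apply: eq_lah_mean => j /=; rewrite -natr1.
rewrite !shift /avg_gap /lah_avg.
have := stay_mass n0 kn; have := drop_mass n0 kn.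
set u := lah_mean n k (fun=> 1); set u' := lah_mean n _ (fun=> 1).
set e := lah_mean n k _; set e' := lah_mean n _ _ => hd hs.
have n1 := natrS_neq0 n; have nn : n%:R != 0 :> R by rewrite pnatr_eq0 -lt0n.
transitivity ((n.+1%:R - k%:R) / n.+1%:R * e
  + k%:R * ((n.+1%:R - k%:R) * u + (n.+1%:R - k%:R) * e) / (n.+1%:R * n%:R)
  + (drop_prob n k * e' + drop_prob n k * u')).
  by ring.
rewrite hd hs /drop_prob; field.
by rewrite nn nat1r n1.
Qed.

(** The law of total variance for one step of the chain. *)
Lemma lah_var_rec n k : (0 < n)%N -> (0 < k <= n.+1)%N ->
  lah_var n.+1 k = step_var n k + (1 - drop_prob n k) * lah_var n k
     + drop_prob n k * lah_var n k.-1.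
Proof.
move=> n0 kn; rewrite /lah_var lah_avg_rec // lah_mean_rec //= -/(drop_prob n k).
have shift i : lah_mean n i ((fun j => j%:R ^+ 2) \o succn)
    = lah_mean n i (fun j => j%:R ^+ 2) + 2 * lah_avg n i + lah_mean n i (fun=> 1) :> R.
  rewrite /lah_avg -lah_meanZ -!lah_meanD.
  by apply: eq_lah_mean => j /=; rewrite -natr1; ring.
rewrite !shift /step_var /avg_gap.
have := stay_mass n0 kn; have := drop_mass n0 kn.
set e := lah_avg n k; set e' := lah_avg n _.
set u := lah_mean n k (fun=> 1); set u' := lah_mean n _ (fun=> 1).
set s := lah_mean n k _; set s' := lah_mean n _ _ => hd hs.
have n1 := natrS_neq0 n; have nn : n%:R != 0 :> R by rewrite pnatr_eq0 -lt0n.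
transitivity ((n.+1%:R - k%:R) / n.+1%:R * s
  + k%:R * ((n.+1%:R - k%:R) * u + (n.+1%:R - k%:R) * (s + 2 * e)) / (n.+1%:R * n%:R)
  + (drop_prob n k * (s' + 2 * e') + drop_prob n k * u')
  - (e + k%:R / n.+1%:R - drop_prob n k * (e - e')) ^+ 2).
  by ring.
rewrite hd hs /drop_prob; field.
by rewrite nn nat1r n1.
Qed.

Lemma recip_sum_nn n : recip_sum n n = n%:R^-1.
Proof. by rewrite /recip_sum big_nat1. Qed.

Lemma recip_sumS k n : (k <= n.+1)%N ->
  recip_sum k n.+1 = recip_sum k n + n.+1%:R^-1.
Proof. by move=> kn; rewrite /recip_sum big_nat_recr. Qed.

Lemma recip_sum_pred k n : (k <= n)%N ->
  recip_sum k n = k%:R^-1 + recip_sum k.+1 n.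
Proof. by move=> kn; rewrite /recip_sum big_ltn. Qed.

Lemma recip_sqr_sum_nn n : recip_sqr_sum n n = (n%:R ^+ 2)^-1.
Proof. by rewrite /recip_sqr_sum big_nat1. Qed.

Lemma recip_sqr_sumS k n : (k <= n.+1)%N ->
  recip_sqr_sum k n.+1 = recip_sqr_sum k n + (n.+1%:R ^+ 2)^-1.
Proof. by move=> kn; rewrite /recip_sqr_sum big_nat_recr. Qed.

Lemma recip_sqr_sum_pred k n : (k <= n)%N ->
  recip_sqr_sum k n = (k%:R ^+ 2)^-1 + recip_sqr_sum k.+1 n.
Proof. by move=> kn; rewrite /recip_sqr_sum big_ltn. Qed.

(** The mean is n k times the average of 1/i over k <= i <= n. Such an average
    changes with n or k by rational functions only, so the recursion becomes an
    identity of rational functions. *)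
Lemma lah_avgE n k : (0 < k <= n)%N ->
  lah_avg n k = n%:R * k%:R / (n%:R - k%:R + 1) * recip_sum k n.
Proof.
elim: n k => [|n IH] k; first by case: k.
case: n IH => [|n] IH.
  case: k => [|[|k]] // _; rewrite /lah_avg lah_mean_11 recip_sum_nn.
  by rewrite subrr add0r !invr1 !mulr1.
move=> kn; rewrite lah_avg_rec //.
have N0 : 0 <= n%:R :> R by [].
case/andP: kn => k0; rewrite leq_eqVlt => /predU1P[->|].
  (* a void law, of mean zero by convention, with a drop of probability one *)
  rewrite /avg_gap /= [lah_avg _ n.+2]lah_mean0 ?ltnn //.
  rewrite IH ?leqnn // !recip_sum_nn /drop_prob; field; nonzero.
rewrite ltnS => kn; have kn2 : (k <= n.+2)%N by exact: leqW.
rewrite IH ?k0 // (recip_sumS (n := n.+1)) //.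
case: k k0 kn {kn2} => [//|[|k]] _ kn.
  rewrite /drop_prob /= subrr mulr0 !mul0r subr0; field; nonzero.
have kn' : k%:R + 1 <= n%:R :> R by rewrite natr1 ler_nat -ltnS.
have K0 : 0 <= k%:R :> R by [].
rewrite /avg_gap IH ?kn // /= IH ?(ltnW kn) // [recip_sum k.+1 _]recip_sum_pred ?(ltnW kn) //.
rewrite /drop_prob; field; nonzero.
Qed.

Lemma lah_varE n k : (0 < k <= n)%N ->
  let r : R := n%:R - k%:R + 1 in
  let A := recip_sum k n / r in let B := recip_sqr_sum k n / r in
  lah_var n k = n%:R * k%:R / (r + 1) *
    ((n%:R + k%:R) * A - (n%:R * k%:R + 1) * B
     - (k%:R - 1) * (n%:R + 1) * A ^+ 2).
Proof.
elim: n k => [|n IH] k; first by case: k.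
case: n IH => [|n] IH.
  case: k => [|[|k]] // _; rewrite /lah_var /lah_avg !lah_mean_11 recip_sum_nn.
  by rewrite /= recip_sqr_sum_nn; field.
move=> kn r A B; rewrite lah_var_rec //.
have N0 : 0 <= n%:R :> R by [].
rewrite {}/A {}/B {}/r; case/andP: kn => k0.
rewrite leq_eqVlt => /predU1P[->|].
  rewrite /step_var /= [lah_var _ n.+2]/lah_var /lah_avg !lah_mean0 ?ltnn //.
  rewrite IH ?leqnn // !recip_sum_nn !recip_sqr_sum_nn /drop_prob; field; nonzero.
rewrite ltnS => kn; have kn2 : (k <= n.+2)%N by exact: leqW.
rewrite IH ?k0 // (recip_sumS (n := n.+1)) //.
rewrite (recip_sqr_sumS (n := n.+1)) //.
case: k k0 kn {kn2} => [//|[|k]] _ kn.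
  by rewrite /step_var /drop_prob /= subrr !(mulr0, mul0r) subr0; field; nonzero.
have kn' : k%:R + 1 <= n%:R :> R by rewrite natr1 ler_nat -ltnS.
have K0 : 0 <= k%:R :> R by [].
rewrite IH ?(ltnW kn) // /step_var /avg_gap !lah_avgE ?kn ?(ltnW kn) //=.
rewrite [recip_sum k.+1 _]recip_sum_pred ?(ltnW kn) //.
rewrite [recip_sqr_sum k.+1 _]recip_sqr_sum_pred ?(ltnW kn) //.
rewrite /drop_prob; field; nonzero.
Qed.

(** * Partial harmonic sums *)

Lemma sumr_const_range k n (c : R) : (k <= n)%N ->
  \sum_(k <= i < n.+1) c = (n%:R - k%:R + 1) * c.
Proof.
by move=> kn; rewrite sumr_const_nat subSn // mulrS -(mulr_natl c) natrB //; ring.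
Qed.

(** Pairing i with n + k - i makes each term a function of i (n + k - i),
    which lies between n k and (n + k)^2 / 4; this gives both bounds on the
    average of 1/i below. *)
Lemma recip_sum_paired k n : (0 < k <= n)%N ->
  2 * recip_sum k n =
  \sum_(k <= i < n.+1) (n%:R + k%:R) / (i%:R * (n%:R + k%:R - i%:R)).
Proof.
move=> /andP[k0 kn]; have K0 : 1 <= k%:R :> R by rewrite ler1n.
have -> : 2 * recip_sum k n = recip_sum k n + recip_sum k n by ring.
rewrite [X in _ + X]/recip_sum big_nat_rev /= -big_split /=.
apply: eq_big_nat => i /andP[ki]; rewrite ltnS => ni.
rewrite addnS subSS natrB; last by rewrite (leq_trans ni) ?leq_addl.
have KI : k%:R <= i%:R :> R by rewrite ler_nat.
have NI : i%:R <= n%:R :> R by rewrite ler_nat.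
by rewrite natrD; field; nonzero.
Qed.

Lemma recip_sum_lb k n : (0 < k <= n)%N ->
  2 / (n%:R + k%:R) <= recip_sum k n / (n%:R - k%:R + 1).
Proof.
move=> kn; case/andP: (kn) => k0 kn'; have K0 : 1 <= k%:R :> R by rewrite ler1n.
have KN : k%:R <= n%:R :> R by rewrite ler_nat.
rewrite ler_pdivlMr; last lra.
rewrite -(ler_pM2l (x := 2)) ?ltr0n // recip_sum_paired //.
have -> : 2 * (2 / (n%:R + k%:R) * (n%:R - k%:R + 1))
    = (n%:R - k%:R + 1) * (4 / (n%:R + k%:R)) :> R by ring.
rewrite -sumr_const_range //; apply: ler_sum_nat => i /andP[ki]; rewrite ltnS => ni.
have KI : k%:R <= i%:R :> R by rewrite ler_nat.
have NI : i%:R <= n%:R :> R by rewrite ler_nat.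
set S := n%:R + k%:R; rewrite ler_pdivrMr; last by rewrite /S; lra.
rewrite mulrAC ler_pdivlMr; last by apply: mulr_gt0; rewrite /S; lra.
rewrite -subr_ge0.
have -> : S * S - 4 * (i%:R * (S - i%:R)) = (S - 2 * i%:R) ^+ 2 by ring.
exact: sqr_ge0.
Qed.

Lemma recip_sum_ub k n : (0 < k <= n)%N ->
  recip_sum k n / (n%:R - k%:R + 1) <= (n%:R + k%:R) / (2 * n%:R * k%:R).
Proof.
move=> kn; case/andP: (kn) => k0 kn'; have K0 : 1 <= k%:R :> R by rewrite ler1n.
have KN : k%:R <= n%:R :> R by rewrite ler_nat.
rewrite ler_pdivrMr; last lra.
rewrite -(ler_pM2l (x := 2)) ?ltr0n // recip_sum_paired //.
have -> : 2 * ((n%:R + k%:R) / (2 * n%:R * k%:R) * (n%:R - k%:R + 1))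
    = (n%:R - k%:R + 1) * ((n%:R + k%:R) / (n%:R * k%:R)) :> R.
  field; nonzero.
rewrite -sumr_const_range //; apply: ler_sum_nat => i /andP[ki]; rewrite ltnS => ni.
have KI : k%:R <= i%:R :> R by rewrite ler_nat.
have NI : i%:R <= n%:R :> R by rewrite ler_nat.
apply: ler_wpM2l; first lra.
rewrite lef_pV2 ?posrE; [|apply: mulr_gt0; lra|apply: mulr_gt0; lra].
rewrite -subr_ge0.
have -> : i%:R * (n%:R + k%:R - i%:R) - n%:R * k%:R
    = (i%:R - k%:R) * (n%:R - i%:R) :> R by ring.
by apply: mulr_ge0; lra.
Qed.

Lemma recip_consecutive k n : (0 < k <= n)%N ->
  \sum_(k <= i < n.+1) (i%:R * (i%:R + 1))^-1
    = (n%:R - k%:R + 1) / (k%:R * (n%:R + 1)) :> R.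
Proof.
case/andP=> k0; elim: n => [|n IH]; first by case: k k0.
have K0 : 1 <= k%:R :> R by rewrite ler1n.
have N0 : 0 <= n%:R :> R by [].
rewrite leq_eqVlt => /predU1P[->|kn].
  by rewrite big_nat1; field; nonzero.
rewrite big_nat_recr ?leqW // IH // /=; set N : R := n%:R in N0 *.
have KN : k%:R <= N by rewrite ler_nat.
by field; nonzero.
Qed.

Lemma recip_sqr_sum_ub k n : (0 < k <= n)%N ->
  recip_sqr_sum k n <= (1 + k%:R^-1) * ((n%:R - k%:R + 1) / (k%:R * (n%:R + 1))).
Proof.
move=> kn; rewrite -recip_consecutive // mulr_sumr.
case/andP: kn => k0 kn; have K0 : 1 <= k%:R :> R by rewrite ler1n.
apply: ler_sum_nat => i /andP[ki _].
have KI : k%:R <= i%:R :> R by rewrite ler_nat.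
have -> : (i%:R ^+ 2)^-1 = (1 + i%:R^-1) * (i%:R * (i%:R + 1))^-1 :> R.
  by field; nonzero.
apply: ler_wpM2r; first by rewrite invr_ge0 mulr_ge0 ?addr_ge0.
by rewrite lerD2l lef_pV2 ?posrE; lra.
Qed.

Lemma recip_sqr_sum_lb k n : (0 < k <= n)%N ->
  (n%:R - k%:R + 1) / (k%:R * (n%:R + 1)) <= recip_sqr_sum k n.
Proof.
move=> kn; rewrite -recip_consecutive //.
case/andP: kn => k0 kn; have K0 : 1 <= k%:R :> R by rewrite ler1n.
apply: ler_sum_nat => i /andP[ki _].
have KI : k%:R <= i%:R :> R by rewrite ler_nat.
have I0 : 0 < i%:R :> R by lra.
rewrite lef_pV2 ?posrE; [|by apply: mulr_gt0; lra|exact: exprn_gt0].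
by rewrite expr2 ler_wpM2l; lra.
Qed.

(** The square of an average is at most the average of the squares. For k much
    smaller than n this is better than the square of the bound recip_sum_ub. *)
Lemma recip_sum_sqr_ub k n : (0 < k <= n)%N ->
  (recip_sum k n / (n%:R - k%:R + 1)) ^+ 2 <= 2 / (k%:R * (n%:R + 1)).
Proof.
move=> kn; case/andP: (kn) => k0 kn'; have K0 : 1 <= k%:R :> R by rewrite ler1n.
have KN : k%:R <= n%:R :> R by rewrite ler_nat.
set r := n%:R - k%:R + 1; have r0 : 0 < r by rewrite /r; lra.
set t := recip_sum k n / r.
have : 0 <= \sum_(k <= i < n.+1) (i%:R^-1 - t) ^+ 2.
  by apply: sumr_ge0 => i _; exact: sqr_ge0.
have -> : \sum_(k <= i < n.+1) (i%:R^-1 - t) ^+ 2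
    = recip_sqr_sum k n - 2 * t * recip_sum k n + r * t ^+ 2.
  rewrite /recip_sqr_sum /recip_sum mulr_sumr -sumr_const_range // -sumrB -big_split /=.
  by apply: eq_bigr => i _; rewrite -exprVn; ring.
have -> : recip_sum k n = r * t by rewrite /t; field; exact: lt0r_neq0.
move=> h; have hb := recip_sqr_sum_ub kn.
have : recip_sqr_sum k n <= 2 * (r / (k%:R * (n%:R + 1))).
  apply: le_trans hb _; apply: ler_wpM2r.
    apply: divr_ge0; [exact: ltW|by apply: mulr_ge0; lra].
  have : k%:R^-1 <= 1 :> R by rewrite invf_le1; lra.
  lra.
move=> hb'; rewrite -(ler_pM2l r0).
have -> : r * (2 / (k%:R * (n%:R + 1))) = 2 * (r / (k%:R * (n%:R + 1))) by ring.
lra.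
Qed.

(** * One step of the chain *)

(** The closed form of avg_gap, with A the average of 1/i over k <= i <= n. *)
Definition gap_of (N K A : R) : R := N * ((N + 1) * A - 1) / (N - K + 2).

Lemma gap_of_bounds (N K A : R) : 1 <= K -> K <= N ->
  2 / (N + K) <= A -> A <= (N + K) / (2 * N * K) -> A ^+ 2 <= 2 / (K * (N + 1)) ->
  [/\ 0 <= gap_of N K A, gap_of N K A <= N / (2 * K)
    & gap_of N K A ^+ 2 <= 2 * N / K].
Proof.
move=> K1 KN lA uA sA; rewrite /gap_of.
have A0 : 0 <= A by apply: le_trans lA; rewrite divr_ge0; lra.
have lA' : 2 <= A * (N + K) by rewrite -ler_pdivrMr //; lra.
have uA' : A * (2 * N * K) <= N + K.
  by rewrite -ler_pdivlMr //; apply: mulr_gt0; [apply: mulr_gt0|]; lra.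
have NA1 : 1 <= N * A by nra.
have KA1 : K * A <= 1 by rewrite -(ler_pM2l (x := 2 * N)); [lra|lra].
have gap0 : 0 <= N * ((N + 1) * A - 1) / (N - K + 2).
  rewrite divr_ge0; [by []|apply: mulr_ge0; nra|lra].
split=> //.
  rewrite ler_pdivrMr; last lra.
  rewrite mulrAC ler_pdivlMr; last lra.
  nra.
have le1 : N * ((N + 1) * A - 1) / (N - K + 2) <= N * A.
  by rewrite ler_pdivrMr; nra.
apply: (@le_trans _ _ ((N * A) ^+ 2)); first by rewrite ler_sqr ?nnegrE //; nra.
rewrite exprMn; apply: (@le_trans _ _ (N ^+ 2 * (2 / (K * (N + 1))))).
  by apply: ler_wpM2l => //; exact: sqr_ge0.
have -> : N ^+ 2 * (2 / (K * (N + 1))) = 2 * N / K * (N / (N + 1)).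
  by field; nonzero.
rewrite -[leRHS]mulr1; apply: ler_wpM2l; first by rewrite divr_ge0; lra.
by rewrite ler_pdivrMr; lra.
Qed.

(** Extending the range of the average by the index K - 1 turns A into A'. *)
Lemma gap_of_pred (N K A A' : R) : 2 <= K -> K <= N ->
  2 / (N + K) <= A -> A <= (N + K) / (2 * N * K) ->
  A' = ((N - K + 1) * A + (K - 1)^-1) / (N - K + 2) ->
  0 <= gap_of N (K - 1) A' - gap_of N K A <= N / (2 * K * (K - 1)).
Proof.
move=> K1 KN lA uA eA'.
have -> : gap_of N (K - 1) A' - gap_of N K A =
   N / ((N - K + 2) * (N - K + 3)) * ((N + K) / (K - 1) - 2 * (N + 1) * A).
  by rewrite /gap_of eA'; field; nonzero.
have lA' : 2 <= A * (N + K) by rewrite -ler_pdivrMr //; lra.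
have uA' : A * (2 * N * K) <= N + K.
  by rewrite -ler_pdivlMr //; apply: mulr_gt0; [apply: mulr_gt0|]; lra.
have r0 : 0 < (N - K + 2) * (N - K + 3) by apply: mulr_gt0; lra.
apply/andP; split.
  apply: mulr_ge0; first by rewrite divr_ge0; lra.
  rewrite subr_ge0 ler_pdivlMr; last lra.
  rewrite -(ler_pM2l (x := N * K)); last by apply: mulr_gt0; lra.
  have : (N + 1) * (K - 1) * (A * (2 * N * K)) <= (N + 1) * (K - 1) * (N + K).
    by apply: ler_wpM2l => //; apply: mulr_ge0; lra.
  nra.
have h : (N + K) / (K - 1) - 2 * (N + 1) * A
    <= (N - K + 2) ^+ 2 / ((K - 1) * (N + K)).
  have -> : (N - K + 2) ^+ 2 / ((K - 1) * (N + K))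
     = (N + K) / (K - 1) - 2 * (N + 1) * (2 / (N + K)) by field; nonzero.
  by rewrite lerD2l lerN2; apply: ler_wpM2l => //; lra.
apply: (@le_trans _ _ (N / ((N - K + 2) * (N - K + 3)) *
   ((N - K + 2) ^+ 2 / ((K - 1) * (N + K))))).
  by apply: ler_wpM2l => //; rewrite divr_ge0; lra.
have -> : N / ((N - K + 2) * (N - K + 3)) * ((N - K + 2) ^+ 2 / ((K - 1) * (N + K)))
   = (N / (K - 1)) * ((N - K + 2) / ((N - K + 3) * (N + K))) by field; nonzero.
have -> : N / (2 * K * (K - 1)) = N / (K - 1) * (2 * K)^-1 by field; nonzero.
apply: ler_wpM2l; first by rewrite divr_ge0; lra.
rewrite ler_pdivrMr; last by apply: mulr_gt0; lra.
by rewrite ler_pdivlMl; nra.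
Qed.

Definition step_var_of (N K x : R) : R :=
  let rho := K / (N + 1) in let q := K * (K - 1) / ((N + 1) * N) in
  rho * (1 - rho) + x ^+ 2 * q * (1 - q) - 2 * x * q * (1 - rho).

(** Here w = q x and w' = q' y are the mean effects of a drop at K and at K - 1;
    T1 - T2 is the difference w - w' and T3 - T4 that of q x^2 and q' y^2; im
    is 1/(N+1), and iK is 1/K. *)
Lemma step_var_error (im iK K w w' T1 T2 T3 T4 : R) :
  0 <= im -> im <= iK -> 1 <= K -> K * im <= 1 ->
  0 <= w <= 1/2 -> 0 <= w' <= 1/2 -> 0 <= T1 <= im -> 0 <= T2 <= im ->
  0 <= T3 <= 4 * im -> 0 <= T4 <= iK ->
  `|im * ((1 - K * im) - (K - 1) * im) + (T3 - T4) - (T1 - T2) * (w + w')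
    - 2 * ((T1 - T2) * (1 - K * im) - w' * im)| <= 10 * iK.
Proof.
move=> im0 imK K1 Km /andP[w0 w1] /andP[w'0 w'1] /andP[? ?] /andP[? ?].
move=> /andP[? ?] /andP[? ?].
have Km0 : 0 <= K * im by rewrite mulr_ge0 //; lra.
have K1m : 0 <= (K - 1) * im by rewrite mulr_ge0 //; lra.
have dT : `|T1 - T2| <= im by rewrite ler_norml; apply/andP; split; lra.
have a1 : `|im * ((1 - K * im) - (K - 1) * im)| <= im.
  by rewrite normrM (ger0_norm im0) -[leRHS]mulr1 ler_wpM2l // ler_norml;
     apply/andP; split; lra.
have a3 : `|(T1 - T2) * (w + w')| <= im.
  rewrite normrM -[leRHS]mulr1; apply: ler_pM => //.
  by rewrite ger0_norm; lra.
have a4 : `|(T1 - T2) * (1 - K * im)| <= im.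
  rewrite normrM -[leRHS]mulr1; apply: ler_pM => //.
  by rewrite ger0_norm; lra.
have a5 : `|w' * im| <= im.
  rewrite normrM (ger0_norm im0) ger0_norm // -[leRHS]mul1r ler_wpM2r //; lra.
move: a1 a3 a4 a5; rewrite !ler_norml {dT K1m Km0 Km}.
by move=> /andP[? ?] /andP[? ?] /andP[? ?] /andP[? ?]; apply/andP; split; lra.
Qed.

(** Here x and y are the gaps of the mean at K and K - 1. The individual terms
    of the one-step variance need not be small in 1/K; their differences are,
    since x and y, as well as the two drop probabilities, are close. *)
Lemma step_var_of_diff (N K x y : R) : 2 <= K -> K <= N ->
  0 <= x -> x <= N / (2 * K) -> x ^+ 2 <= 2 * N / K ->
  y <= N / (2 * (K - 1)) ->
  0 <= y - x <= N / (2 * K * (K - 1)) ->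
  `|step_var_of N K x - step_var_of N (K - 1) y| <= 10 / K.
Proof.
move=> K2 KN x0 xub x2 yub /andP[yx yx'].
set m := N + 1; have m0 : 0 < m by rewrite /m; lra.
set q := K * (K - 1) / (m * N); set q' := (K - 1) * (K - 2) / (m * N).
set w := q * x; set w' := q' * y.
set iK := K^-1; set im := m^-1.
have mN : 0 < m * N by apply: mulr_gt0; lra.
have q0 : 0 <= q by rewrite divr_ge0 ?mulr_ge0; lra.
have q'0 : 0 <= q' by rewrite divr_ge0 ?mulr_ge0; lra.
have im0 : 0 <= im by rewrite invr_ge0; lra.
have imK : im <= iK by rewrite lef_pV2 ?posrE /m; lra.
have K1m : (K - 1) * im <= 1 by rewrite ler_pdivrMr /m; lra.
have w0 : 0 <= w by rewrite mulr_ge0.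
have w'0 : 0 <= w' by rewrite mulr_ge0 //; lra.
have wub : w <= 1/2.
  apply: (@le_trans _ _ (q * (N / (2 * K)))); first by rewrite ler_wpM2l.
  have -> : q * (N / (2 * K)) = (K - 1) * im / 2 by rewrite /q /im; field; nonzero.
  lra.
have w'ub : w' <= 1/2.
  apply: (@le_trans _ _ (q' * (N / (2 * (K - 1))))); first by rewrite ler_wpM2l.
  have -> : q' * (N / (2 * (K - 1))) = (K - 2) * im / 2 by rewrite /q' /im; field; nonzero.
  have : (K - 2) * im <= (K - 1) * im by apply: ler_wpM2r => //; lra.
  lra.
have dq : q - q' = 2 * (K - 1) / (m * N) by rewrite /q /q'; field; nonzero.
have dq0 : 0 <= q - q' by rewrite dq divr_ge0; lra.
have t1 : (q - q') * x <= im.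
  apply: (@le_trans _ _ ((q - q') * (N / (2 * K)))); first by rewrite ler_wpM2l.
  have -> : (q - q') * (N / (2 * K)) = im * ((K - 1) / K).
    by rewrite dq /im; field; nonzero.
  by rewrite -[leRHS]mulr1 ler_wpM2l // ler_pdivrMr; lra.
have t1p : 0 <= (q - q') * x by rewrite mulr_ge0.
have t2 : q' * (y - x) <= im.
  apply: (@le_trans _ _ (q' * (N / (2 * K * (K - 1))))); first by rewrite ler_wpM2l.
  have -> : q' * (N / (2 * K * (K - 1))) = im * ((K - 2) / (2 * K)).
    by rewrite /q' /im; field; nonzero.
  by rewrite -[leRHS]mulr1 ler_wpM2l // ler_pdivrMr; lra.
have t2p : 0 <= q' * (y - x) by rewrite mulr_ge0.
have t3 : (q - q') * x ^+ 2 <= 4 * im.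
  apply: (@le_trans _ _ ((q - q') * (2 * N / K))); first by rewrite ler_wpM2l.
  have -> : (q - q') * (2 * N / K) = im * (4 * ((K - 1) / K)).
    by rewrite dq /im; field; nonzero.
  rewrite [leRHS]mulrC; apply: ler_wpM2l => //.
  have : (K - 1) / K <= 1 by rewrite ler_pdivrMr; lra.
  lra.
have t3p : 0 <= (q - q') * x ^+ 2 by rewrite mulr_ge0 // sqr_ge0.
have t4 : q' * (y - x) * (y + x) <= iK.
  have s : y + x <= N / (K - 1).
    have -> : N / (K - 1) = 2 * (N / (2 * (K - 1))) by field; nonzero.
    lra.
  apply: (@le_trans _ _ (q' * (N / (2 * K * (K - 1))) * (N / (K - 1)))).
    by apply: ler_pM => //; [lra|rewrite ler_wpM2l].
  have -> : q' * (N / (2 * K * (K - 1))) * (N / (K - 1))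
     = iK * (((K - 2) / (K - 1)) * (N / (2 * m))).
    by rewrite /q' /iK; field; nonzero.
  have iK0 : 0 <= iK by lra.
  rewrite -[leRHS]mulr1 ler_wpM2l //.
  have u1 : 0 <= (K - 2) / (K - 1) by apply: divr_ge0; lra.
  have u2 : (K - 2) / (K - 1) <= 1 by rewrite ler_pdivrMr; lra.
  have u3 : 0 <= N / (2 * m) by apply: divr_ge0; lra.
  have u4 : N / (2 * m) <= 1 by rewrite ler_pdivrMr /m; lra.
  exact: mulr_ile1.
have t4p : 0 <= q' * (y - x) * (y + x) by rewrite mulr_ge0 //; lra.
have -> : step_var_of N K x - step_var_of N (K - 1) y =
   im * ((1 - K * im) - (K - 1) * im)
   + ((q - q') * x ^+ 2 - q' * (y - x) * (y + x))
   - ((q - q') * x - q' * (y - x)) * (w + w')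
   - 2 * (((q - q') * x - q' * (y - x)) * (1 - K * im) - w' * im).
  rewrite /step_var_of /w /w' /q /q' /im -/m; field; nonzero.
have wb : 0 <= w <= 1/2 by rewrite w0.
have w'b : 0 <= w' <= 1/2 by rewrite w'0.
have T1b : 0 <= (q - q') * x <= im by rewrite t1p.
have T2b : 0 <= q' * (y - x) <= im by rewrite t2p.
have T3b : 0 <= (q - q') * x ^+ 2 <= 4 * im by rewrite t3p.
have T4b : 0 <= q' * (y - x) * (y + x) <= iK by rewrite t4p.
apply: step_var_error => //; first lra.
by rewrite ler_pdivrMr /m; lra.
Qed.

Definition recip_avg k n : R := recip_sum k n / (n%:R - k%:R + 1).

Definition gap n k : R := gap_of n%:R k%:R (recip_avg k n).

Lemma avg_gapE n k : (1 < k <= n)%N -> avg_gap n k = gap n k.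
Proof.
case: k => [|[|k]] // /andP[_ kn].
have N0 : 0 <= n%:R :> R by [].
have K0 : 0 <= k%:R :> R by [].
have KN : k%:R + 2 <= n%:R :> R by rewrite -natrD ler_nat addn2.
rewrite /avg_gap !lah_avgE ?kn ?(ltnW kn) //= /gap /gap_of /recip_avg.
rewrite [recip_sum k.+1 _]recip_sum_pred ?(ltnW kn) //.
by field; nonzero.
Qed.

Lemma gap_bounds n k : (0 < k <= n)%N ->
  [/\ 0 <= gap n k, gap n k <= n%:R / (2 * k%:R) & gap n k ^+ 2 <= 2 * n%:R / k%:R].
Proof.
move=> kn; apply: gap_of_bounds.
- by rewrite ler1n; case/andP: kn.
- by rewrite ler_nat; case/andP: kn.
- exact: recip_sum_lb.
- exact: recip_sum_ub.
- exact: recip_sum_sqr_ub.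
Qed.

Lemma gap_pred n k : (1 < k <= n)%N ->
  0 <= gap n k.-1 - gap n k <= n%:R / (2 * k%:R * (k%:R - 1)).
Proof.
move=> kn; have kn' : (0 < k <= n)%N by case/andP: kn => /ltnW -> ->.
case/andP: kn => k1 kn.
have K0 : 2 <= k%:R :> R by rewrite ler_nat.
have KN : k%:R <= n%:R :> R by rewrite ler_nat.
have -> : gap n k.-1 = gap_of n%:R (k%:R - 1) (recip_avg k.-1 n).
  by rewrite /gap; case: k k1 {kn kn' K0 KN} => // k _; rewrite -natr1 addrK.
apply: gap_of_pred => //; [exact: recip_sum_lb|exact: recip_sum_ub|].
case: k k1 kn K0 KN {kn'} => [//|k] k1 kn.
rewrite /recip_avg /= (recip_sum_pred (ltnW kn)) -natr1 => K0 KN.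
by field; nonzero.
Qed.

Lemma step_var_gap n k : (0 < k <= n)%N ->
  step_var n k = step_var_of n%:R k%:R (gap n k).
Proof.
move=> kn; rewrite /step_var /step_var_of /drop_prob natr1.
case: k kn => [//|[|k]] kn; last by rewrite avg_gapE.
by rewrite subrr !(mulr0, mul0r).
Qed.

Lemma step_varS n : (0 < n)%N -> step_var n n.+1 = 0.
Proof.
move=> n0; rewrite /step_var /drop_prob.
have N0 : 1 <= n%:R :> R by rewrite ler1n.
by field; nonzero.
Qed.

Lemma step_var_diff n k : (0 < n)%N -> (1 < k <= n.+1)%N ->
  `|step_var n k - step_var n k.-1| <= 10 / k%:R.
Proof.
move=> n0 /andP[k1]; have N0 : 1 <= n%:R :> R by rewrite ler1n.
rewrite leq_eqVlt => /predU1P[->|].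
  rewrite step_varS //= step_var_gap ?n0 ?leqnn // sub0r normrN.
  have -> : step_var_of n%:R n%:R (gap n n) = 1 / (2 * (n%:R + 1)) :> R.
    by rewrite /step_var_of /gap /gap_of /recip_avg recip_sum_nn; field; nonzero.
  rewrite ger0_norm; last by apply: divr_ge0; lra.
  rewrite -natr1 ler_pdivrMr; last lra.
  by rewrite mulrAC ler_pdivlMr; lra.
rewrite ltnS => kn.
have kn1 : (1 < k <= n)%N by rewrite k1.
have kn0 : (0 < k <= n)%N by rewrite (ltnW k1).
have kn2 : (0 < k.-1 <= n)%N by case: k k1 kn {kn1 kn0} => [|[|k]] //= _ /ltnW.
have [x0 x1 x2] := gap_bounds kn0.
have [_ y1 _] := gap_bounds kn2.
have K1 : k.-1%:R = k%:R - 1 :> R.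
  by case: k k1 {kn kn1 kn0 kn2 x0 x1 x2 y1} => // k _; rewrite -natr1 addrK.
rewrite !step_var_gap // K1; apply: step_var_of_diff => //.
- by rewrite ler_nat.
- by rewrite ler_nat.
- by rewrite -K1.
- exact: gap_pred.
Qed.

Lemma drop_probS n : (0 < n)%N -> drop_prob n n.+1 = 1.
Proof.
move=> n0; have N0 : 1 <= n%:R :> R by rewrite ler1n.
by rewrite /drop_prob; field; nonzero.
Qed.

Lemma drop_prob1 n : drop_prob n 1 = 0.
Proof. by rewrite /drop_prob subrr mulr0 mul0r. Qed.

Lemma drop_prob_ge0 n k : 0 <= drop_prob n k.
Proof.
case: k => [|k]; first by rewrite /drop_prob !mul0r.
have e : k.+1%:R - 1 = k%:R :> R by rewrite -natr1 addrK.
by rewrite /drop_prob e divr_ge0.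
Qed.

Lemma drop_prob_le1 n k : (0 < n)%N -> (0 < k <= n.+1)%N -> drop_prob n k <= 1.
Proof.
move=> n0 /andP[k0 kn].
have N0 : 1 <= n%:R :> R by rewrite ler1n.
have K0 : 1 <= k%:R :> R by rewrite ler1n.
have KN : k%:R <= n%:R + 1 :> R by rewrite natr1 ler_nat.
rewrite /drop_prob -natr1 ler_pdivrMr; last by apply: mulr_gt0; lra.
by rewrite mul1r; apply: ler_pM; lra.
Qed.

(** By induction on n, since the recursion for the variance is nearly a
    contraction. A step adds at most 10/k to the difference, and carries over
    the previous differences with weights such that
    (1 - q_k) / k + q_(k-1) / (k-1) = 1/k - 1/(n(n+1)) <= 1/k, where q_k is the
    drop probability from size n+1. *)
Lemma lah_var_gap n k : (1 < k <= n)%N ->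
  `|lah_var n k - lah_var n k.-1| <= 10 * n%:R / k%:R.
Proof.
elim: n k => [|n IH] k; first by case: k => [|[|k]].
case: n IH => [|n] IH; first by case: k => [|[|]].
move=> /andP[k1 kn].
have N0 : 0 <= n%:R :> R by [].
have K0 : 2 <= k%:R :> R by rewrite ler_nat.
have KN : k%:R <= n%:R + 2 :> R by rewrite -natrD addn2 ler_nat.
have K1 : k.-1%:R = k%:R - 1 :> R.
  by case: k k1 {kn K0 KN} => // k _; rewrite -natr1 addrK.
have kn0 : (0 < k <= n.+2)%N by rewrite (ltnW k1).
have kn1 : (0 < k.-1 <= n.+2)%N.
  by rewrite -ltnS prednK ?(ltnW k1) // k1 (leq_trans (leq_pred k)).
rewrite (lah_var_rec _ kn0) // (lah_var_rec _ kn1) //.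
set q := drop_prob _ k; set q' := drop_prob _ k.-1.
set v := lah_var _ k; set v' := lah_var _ k.-1; set v'' := lah_var _ _.
have -> : step_var n.+1 k + (1 - q) * v + q * v' - (step_var n.+1 k.-1 + (1 - q') * v' + q' * v'')
  = (step_var n.+1 k - step_var n.+1 k.-1) + (1 - q) * (v - v') + q' * (v' - v'') by ring.
have g : `|step_var n.+1 k - step_var n.+1 k.-1| <= 10 / k%:R.
  by apply: step_var_diff => //; rewrite k1.
have b1 : `|(1 - q) * (v - v')| <= (1 - q) * (10 * n.+1%:R / k%:R).
  move: kn; rewrite leq_eqVlt => /predU1P[kn|kn].
    by rewrite /q kn drop_probS // subrr !mul0r normr0.
  rewrite normrM ger0_norm; last by rewrite subr_ge0 drop_prob_le1 // (ltnW k1) ltnW.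
  apply: ler_wpM2l; first by rewrite subr_ge0 drop_prob_le1 // (ltnW k1) ltnW.
  by apply: IH; rewrite k1.
have b2 : `|q' * (v' - v'')| <= q' * (10 * n.+1%:R / k.-1%:R).
  case: (ltnP 1 k.-1) => k2; last first.
    have e : k.-1 = 1%N by apply/eqP; rewrite eqn_leq k2 -ltnS prednK // ltnW.
    have -> : q' = 0 by rewrite /q' e drop_prob1.
    by rewrite !mul0r normr0.
  rewrite normrM ger0_norm; last exact: drop_prob_ge0.
  apply: ler_wpM2l; first exact: drop_prob_ge0.
  by apply: IH; rewrite k2 -ltnS (leq_trans _ kn) // prednK // ltnW.
apply: (le_trans (ler_normD _ _)).
apply: (le_trans (lerD (ler_normD _ _) (lexx _))).
apply: (le_trans (lerD (lerD g b1) b2)).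
have -> : 10 / k%:R + (1 - q) * (10 * n.+1%:R / k%:R) + q' * (10 * n.+1%:R / k.-1%:R)
  = 10 * n.+2%:R / k%:R - 10 / n.+2%:R :> R.
  rewrite /q /q' /drop_prob K1; field; nonzero.
by rewrite gerBl divr_ge0.
Qed.

(** A drop has probability q <= (k/n)^2, which compensates the square of the
    jump of the variance and the fourth power of the jump of the mean: the
    former jump and the square of the latter are of order n/k. *)
Lemma step_mean_bounds n k : (0 < n)%N -> (0 < k <= n)%N ->
  let q := drop_prob n k in
  [/\ 0 <= q * avg_gap n k, q * avg_gap n k <= 1/2,
      q * avg_gap n k ^+ 4 <= 4, `|q * (lah_var n k - lah_var n k.-1)| <= 10
    & q * (lah_var n k - lah_var n k.-1) ^+ 2 <= 100].
Proof.
move=> n0 kn q; have q0 : 0 <= q := drop_prob_ge0 n k.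
case/andP: (kn) => k0 kn'.
move: k0; rewrite leq_eqVlt => /predU1P[k1|k1].
  by rewrite /q -k1 drop_prob1 !mul0r normr0; split; lra.
have kn1 : (1 < k <= n)%N by rewrite k1.
rewrite avg_gapE //; have [x0 x1 x2] := gap_bounds kn.
have d := lah_var_gap kn1.
have N0 : 1 <= n%:R :> R by rewrite ler1n.
have K0 : 2 <= k%:R :> R by rewrite ler_nat.
have KN : k%:R <= n%:R :> R by rewrite ler_nat.
set N : R := n%:R in N0 KN x1 x2 d *; set K : R := k%:R in K0 KN x1 x2 d *.
have qK : q <= (K / N) ^+ 2.
  rewrite /q /drop_prob -natr1 -/N -/K exprMn exprVn.
  rewrite ler_pdivrMr; last by apply: mulr_gt0; lra.
  rewrite mulrAC ler_pdivlMr; last by apply: exprn_gt0; lra.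
  rewrite [_ ^+ 2]expr2 [K ^+ 2]expr2.
  apply: ler_pM; [by apply: mulr_ge0; lra|by apply: mulr_ge0; lra| |].
    by apply: ler_wpM2l; lra.
  by apply: ler_wpM2r; lra.
have KN0 : 0 <= K / N by apply: divr_ge0; lra.
have KN1 : K / N <= 1 by rewrite ler_pdivrMr; lra.
have s2 : (K / N) ^+ 2 <= 1 by rewrite expr_le1.
have NK0 : 0 <= N / K by apply: divr_ge0; lra.
have KNi : K / N * (N / K) = 1 by field; nonzero.
have d0 : 0 <= `|lah_var n k - lah_var n k.-1| by [].
set x := gap n k in x0 x1 x2 *; set D := lah_var n k - _ in d d0 *.
have x1' : x <= N / K / 2.
  by apply: (le_trans x1); rewrite (_ : N / (2 * K) = N / K / 2) //; field; nonzero.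
have d' : `|D| <= 10 * (N / K) by rewrite mulrA.
have x2' : x ^+ 2 <= 2 * (N / K) by rewrite mulrA.
set i := K / N in KN0 KN1 s2 KNi qK *; set j := N / K in NK0 KNi x1' x2' d' *.
have ij2 : i ^+ 2 * j ^+ 2 = 1 by rewrite -exprMn KNi expr1n.
have ij : i ^+ 2 * j = i by rewrite expr2 -mulrA KNi mulr1.
have q1 y b : 0 <= y -> y <= b -> q * y <= i ^+ 2 * b by move=> ? ?; apply: ler_pM.
split.
- by apply: mulr_ge0.
- by have := q1 _ _ x0 x1'; rewrite mulrA ij; lra.
- have -> : x ^+ 4 = (x ^+ 2) ^+ 2 by rewrite -exprM.
  have h : (x ^+ 2) ^+ 2 <= (2 * j) ^+ 2.
    by rewrite ler_sqr ?nnegrE ?sqr_ge0 //; lra.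
  have := q1 _ _ (sqr_ge0 (x ^+ 2)) h.
  have -> : i ^+ 2 * (2 * j) ^+ 2 = 4 * (i ^+ 2 * j ^+ 2) by ring.
  by rewrite ij2; lra.
- rewrite normrM (ger0_norm q0); have := q1 _ _ d0 d'.
  have -> : i ^+ 2 * (10 * j) = 10 * (i ^+ 2 * j) by ring.
  by rewrite ij; lra.
- have h : D ^+ 2 <= (10 * j) ^+ 2.
    by rewrite -[D ^+ 2]real_normK ?num_real // ler_sqr ?nnegrE //; lra.
  have := q1 _ _ (sqr_ge0 D) h.
  have -> : i ^+ 2 * (10 * j) ^+ 2 = 100 * (i ^+ 2 * j ^+ 2) by ring.
  by rewrite ij2; lra.
Qed.

Definition keep0_prob n k : R := (n.+1%:R - k%:R) / n.+1%:R.
Definition keep1_prob n k : R := k%:R * (n.+1%:R - k%:R) / (n.+1%:R * n%:R).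

Lemma keep0_prob_ge0 n k : (k <= n.+1)%N -> 0 <= keep0_prob n k.
Proof. by move=> kn; rewrite divr_ge0 // subr_ge0 ler_nat. Qed.

Lemma keep1_prob_ge0 n k : (k <= n.+1)%N -> 0 <= keep1_prob n k.
Proof. by move=> kn; rewrite divr_ge0 ?mulr_ge0 // subr_ge0 ler_nat. Qed.

Lemma step_prob_sum n k : (0 < n)%N ->
  keep0_prob n k + keep1_prob n k + drop_prob n k = 1.
Proof.
move=> n0; rewrite /keep0_prob /keep1_prob /drop_prob.
have N0 : 1 <= n%:R :> R by rewrite ler1n.
by field; nonzero.
Qed.

Lemma step_increment_prob n k : (0 < n)%N ->
  keep1_prob n k + drop_prob n k = k%:R / n.+1%:R.
Proof.
move=> n0; rewrite /keep1_prob /drop_prob.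
have N0 : 1 <= n%:R :> R by rewrite ler1n.
by field; nonzero.
Qed.

Lemma lah_var_ge0 n k : (0 < n)%N -> 0 <= lah_var n k.
Proof.
move=> n0; have [kn|kn] := boolP (0 < k <= n)%N; last first.
  by rewrite /lah_var /lah_avg !lah_mean0 // expr0n /= subr0.
have -> : lah_var n k = lah_mean n k (fun j => (j%:R - lah_avg n k) ^+ 2).
  rewrite (@eq_lah_mean n k _ (fun j => (j%:R ^+ 2 + (- 2 * lah_avg n k) * j%:R)
    + lah_avg n k ^+ 2 * 1)); last by move=> j; ring.
  rewrite !lah_meanD !lah_meanZ lah_mean1 // /lah_var /lah_avg; ring.
rewrite lah_meanE; apply: sumr_ge0 => j _.
by rewrite mulr_ge0 ?lah_pmf_ge0 // sqr_ge0.
Qed.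

(* D0, D1, D2 and d, d, d2 are the changes of the conditional mean and variance
   when the first step of the chain is revealed. *)
Section Step.
Context (n k : nat) (n0 : (0 < n)%N) (kn : (0 < k <= n.+1)%N).
Let p0 := keep0_prob n k.
Let p1 := keep1_prob n k.
Let q := drop_prob n k.
Let D0 := lah_avg n k - lah_avg n.+1 k.
Let D1 := 1 + lah_avg n k - lah_avg n.+1 k.
Let D2 := 1 + lah_avg n k.-1 - lah_avg n.+1 k.
Let d := lah_var n k - lah_var n.+1 k.
Let d2 := lah_var n k.-1 - lah_var n.+1 k.

Lemma step_centered : p0 * D0 + p1 * D1 + q * D2 = 0.
Proof.
have hs : p0 = 1 - p1 - q by rewrite -(step_prob_sum k n0) -/p0 -/p1 -/q; ring.
have hi : p1 = k%:R / n.+1%:R - q.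
  by rewrite -(step_increment_prob k n0) -/p1 -/q; ring.
rewrite /D0 /D1 /D2 (lah_avg_rec n0 kn) -/q /avg_gap hs hi; ring.
Qed.

Lemma step_second_moment :
  p0 * (D0 ^+ 2 + d) + p1 * (D1 ^+ 2 + d) + q * (D2 ^+ 2 + d2) = 0.
Proof.
have hs : p0 = 1 - p1 - q by rewrite -(step_prob_sum k n0) -/p0 -/p1 -/q; ring.
have hi : p1 = k%:R / n.+1%:R - q.
  by rewrite -(step_increment_prob k n0) -/p1 -/q; ring.
rewrite /D0 /D1 /D2 /d /d2 (lah_avg_rec n0 kn) (lah_var_rec n0 kn) -/q.
rewrite /step_var /avg_gap -/q hs hi; ring.
Qed.

(** The fourth moment is at most 200. As the second-moment identity forces
    d = q V - S with S the second moment, |d| is at most 212, and the constant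
    4 * 200^2 leaves room for the sum. *)
Lemma step_moment_bound :
  p0 * (D0 ^+ 4 + d ^+ 2) + p1 * (D1 ^+ 4 + d ^+ 2) + q * (D2 ^+ 4 + d2 ^+ 2)
  <= 4 * (200 * 200).
Proof.
have [k0 kn'] := andP kn.
have p0p : 0 <= p0 by exact: keep0_prob_ge0.
have p1p : 0 <= p1 by exact: keep1_prob_ge0.
have q0 : 0 <= q by exact: drop_prob_ge0.
have hs := step_prob_sum k n0; rewrite -/p0 -/p1 -/q in hs.
have e := @lah_avg_rec n k n0 kn; rewrite -/q in e.
have hm := step_second_moment.
move: (kn'); rewrite leq_eqVlt => /predU1P[kE|].
  (* every point is a block of its own, and the step is deterministic *)
  have p00 : p0 = 0 by rewrite /p0 /keep0_prob kE subrr mul0r.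
  have p10 : p1 = 0 by rewrite /p1 /keep1_prob kE subrr mulr0 mul0r.
  have q1 : q = 1 by lra.
  have D20 : D2 = 0.
    by rewrite /D2 e q1 /avg_gap kE divff ?pnatr_eq0 //; ring.
  have d20 : d2 = 0 by move: hm; rewrite p00 p10 q1 D20 !mul0r mul1r expr0n /= !add0r.
  by rewrite p00 p10 D20 d20 !expr0n /= addr0 !mul0r mulr0 !addr0 !mulr_ge0.
rewrite ltnS => kn1; have kn2 : (0 < k <= n)%N by rewrite k0.
have [x0 x1 x4 dq dq2] := @step_mean_bounds n k n0 kn2.
rewrite -/q in x0 x1 x4 dq dq2.
set eta := avg_gap n k in e x0 x1 x4; set V := lah_var n k - _ in dq dq2.
have hd2 : d2 = d - V by rewrite /d2 /d /V; ring.
have D21 : D2 = D1 - eta by rewrite /D2 /D1 /eta /avg_gap; ring.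
set rho : R := k%:R / n.+1%:R in e.
have r0 : 0 <= rho by rewrite divr_ge0.
have r1 : rho <= 1 by rewrite ler_pdivrMr ?mul1r ?ler_nat ?ltr0n.
have D0E : D0 = q * eta - rho by rewrite /D0 e; ring.
have D1E : D1 = 1 + (q * eta - rho) by rewrite /D1 e; ring.
have D04 : D0 ^+ 4 <= 1.
  rewrite D0E; have -> : (q * eta - rho) ^+ 4 = `|q * eta - rho| ^+ 4.
    by rewrite -normrX ger0_norm // exprn_even_ge0.
  by rewrite exprn_ile1 // ler_norml; apply/andP; split; lra.
have D14 : D1 ^+ 4 <= 16.
  have h : 0 <= D1 <= 2 by rewrite D1E; apply/andP; split; lra.
  have -> : 16 = 2 ^+ 4 :> R by ring.
  by case/andP: h => ? ?; rewrite lerXn2r ?nnegrE.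
have D24 : D2 ^+ 4 <= 8 * (D1 ^+ 4 + eta ^+ 4).
  rewrite D21 -subr_ge0.
  have -> : 8 * (D1 ^+ 4 + eta ^+ 4) - (D1 - eta) ^+ 4 =
    4 * (D1 ^+ 2 - eta ^+ 2) ^+ 2
    + (D1 + eta) ^+ 2 * (2 * D1 ^+ 2 + 2 * eta ^+ 2 + (D1 - eta) ^+ 2) by ring.
  apply: addr_ge0; first by rewrite mulr_ge0 // sqr_ge0.
  apply: mulr_ge0; first exact: sqr_ge0.
  have := sqr_ge0 D1; have := sqr_ge0 eta; have := sqr_ge0 (D1 - eta); lra.
have q1 : q <= 1 by lra.
have m0 : p0 * D0 ^+ 4 <= p0 by rewrite -[leRHS]mulr1 ler_wpM2l.
have m1 : p1 * D1 ^+ 4 <= 16 * p1 by rewrite mulrC ler_wpM2r.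
have m2 : q * D2 ^+ 4 <= 160.
  apply: (le_trans (ler_wpM2l q0 D24)).
  have : q * D1 ^+ 4 <= 1 * 16 by apply: ler_pM => //; exact: exprn_even_ge0.
  rewrite mul1r => h.
  have -> : q * (8 * (D1 ^+ 4 + eta ^+ 4)) = 8 * (q * D1 ^+ 4) + 8 * (q * eta ^+ 4) by ring.
  lra.
have m4 : p0 * D0 ^+ 4 + p1 * D1 ^+ 4 + q * D2 ^+ 4 <= 200 by lra.
have amgm (y : R) : y ^+ 2 <= 1 + y ^+ 4.
  have -> : y ^+ 4 = (y ^+ 2) ^+ 2 by rewrite -exprM.
  have := sqr_ge0 (y ^+ 2 - 1); have := sqr_ge0 (y ^+ 2); have := sqr_ge0 y.
  move: (y ^+ 2) => z ? ?; rewrite sqrrB1; lra.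
have b0 := ler_wpM2l p0p (amgm D0); have b1 := ler_wpM2l p1p (amgm D1).
have b2 := ler_wpM2l q0 (amgm D2).
set S := p0 * D0 ^+ 2 + p1 * D1 ^+ 2 + q * D2 ^+ 2.
have S0 : 0 <= S.
  by apply: addr_ge0; [apply: addr_ge0|]; apply: mulr_ge0 => //; exact: sqr_ge0.
have S1 : S <= 201 by rewrite /S; lra.
have dE : d = q * V - S.
  have : S + (p0 + p1 + q) * d - q * V = 0 by rewrite -[RHS]hm hd2 /S; ring.
  by rewrite hs mul1r => h; lra.
have d_ub : d ^+ 2 <= 212 * 212.
  rewrite -expr2 -[d ^+ 2]real_normK ?num_real // ler_sqr ?nnegrE //.
  by rewrite dE; apply: (le_trans (ler_normB _ _)); rewrite (ger0_norm S0); lra.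
have d2_ub : q * d2 ^+ 2 <= 2 * (212 * 212) + 200.
  have h : d2 ^+ 2 <= 2 * d ^+ 2 + 2 * V ^+ 2.
    rewrite hd2 -subr_ge0.
    have -> : 2 * d ^+ 2 + 2 * V ^+ 2 - (d - V) ^+ 2 = (d + V) ^+ 2 by ring.
    exact: sqr_ge0.
  apply: (le_trans (ler_wpM2l q0 h)).
  have : q * d ^+ 2 <= 1 * (212 * 212) by apply: ler_pM => //; exact: sqr_ge0.
  rewrite mul1r => h'.
  have -> : q * (2 * d ^+ 2 + 2 * V ^+ 2) = 2 * (q * d ^+ 2) + 2 * (q * V ^+ 2) by ring.
  lra.
have h0 := ler_wpM2l p0p d_ub; have h1 := ler_wpM2l p1p d_ub.
have -> : p0 * (D0 ^+ 4 + d ^+ 2) + p1 * (D1 ^+ 4 + d ^+ 2) + q * (D2 ^+ 4 + d2 ^+ 2)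
 = (p0 * D0 ^+ 4 + p1 * D1 ^+ 4 + q * D2 ^+ 4) + p0 * d ^+ 2 + p1 * d ^+ 2 + q * d2 ^+ 2 by ring.
clear - m4 d2_ub h0 h1 hs q0; lra.
Qed.

End Step.

(** * Comparison with the heat flow *)

Definition step_const (w0 : R) : R := 16 / w0 ^+ 2 * (2 + 2 * (4 * (200 * 200))).

Lemma step_error_bound (h D d : R) : 0 <= h <= 1 ->
  `|- (h * D)| ^+ 3 + `|- (h * D)| * `|h ^+ 2 * d| + (h ^+ 2 * d) ^+ 2
  <= h ^+ 3 * (2 + 2 * (D ^+ 4 + d ^+ 2)).
Proof.
move=> /andP[h0 h1].
rewrite normrN !normrM (ger0_norm h0).
have D4 : D ^+ 4 = `|D| ^+ 4 by rewrite -normrX ger0_norm // exprn_even_ge0.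
rewrite D4 [(h ^+ 2 * d) ^+ 2]exprMn -[d ^+ 2]real_normK ?num_real //.
move: `|D| `|d| (normr_ge0 D) (normr_ge0 d) => {D4} x y x0 y0.
have e1 : x ^+ 3 <= 1 + x ^+ 4.
  have [x1|x1] := leP x 1.
    have : x ^+ 3 <= 1 by rewrite exprn_ile1.
    by have := exprn_ge0 4 x0; lra.
  have : x ^+ 3 <= x ^+ 4 by rewrite ler_weXn2l // ltW.
  by lra.
have e2 : x * y <= (x ^+ 2 + y ^+ 2) / 2.
  by have := sqr_ge0 (x - y); rewrite sqrrB; lra.
have e3 : x ^+ 2 <= 1 + x ^+ 4.
  have := sqr_ge0 (x ^+ 2 - 1); have : x ^+ 4 = (x ^+ 2) ^+ 2 by rewrite -exprM.
  by have := sqr_ge0 (x ^+ 2); rewrite sqrrB1 => ? -> ?; lra.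
have y2 := sqr_ge0 y; have x4 := exprn_ge0 4 x0.
have h3 : 0 <= h ^+ 3 by exact: exprn_ge0.
have h4 : (h ^+ 2) ^+ 2 * y ^+ 2 <= h ^+ 3 * y ^+ 2.
  by rewrite -exprM; apply: ler_wpM2r => //; exact: ler_wiXn2l.
have -> : (h * x) ^+ 3 + h * x * (h * h * y) = h ^+ 3 * (x ^+ 3 + x * y) by ring.
apply: (@le_trans _ _ (h ^+ 3 * (x ^+ 3 + x * y) + h ^+ 3 * y ^+ 2)).
  by rewrite lerD2l.
by rewrite -mulrDr ler_wpM2l //; lra.
Qed.

Lemma step_const_ge0 (w0 : R) : 0 <= step_const w0.
Proof. by apply: mulr_ge0; [rewrite divr_ge0 ?sqr_ge0|lra]. Qed.

Lemma ler_normD4 (x y z t : R) : `|x + y + z + t| <= `|x| + `|y| + `|z| + `|t|.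
Proof.
apply: (le_trans (ler_normD _ _)); rewrite lerD2r.
apply: (le_trans (ler_normD _ _)); rewrite lerD2r; exact: ler_normD.
Qed.

Lemma ler_norm_wpM2l (p u v : R) : 0 <= p -> `|u| <= v -> `|p * u| <= p * v.
Proof. by move=> pp uv; rewrite normrM (ger0_norm pp) ler_wpM2l. Qed.

(** Mean and variance are (e, v) before the step, (e1, v1) after a step
    without a drop, and (e2, v2) after a drop. *)
Lemma heat_chain_step (w0 h b p0 p1 q e v e1 v1 e2 v2 : R) :
  0 < w0 <= 1 -> 0 <= h <= 1 -> 0 <= p0 -> 0 <= p1 -> 0 <= q -> p0 + p1 + q = 1 ->
  0 <= v -> 0 <= v1 -> 0 <= v2 ->
  let D0 := e1 - e in let D1 := 1 + e1 - e in let D2 := 1 + e2 - e in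
  let d := v1 - v in let d2 := v2 - v in
  p0 * D0 + p1 * D1 + q * D2 = 0 ->
  p0 * (D0 ^+ 2 + d) + p1 * (D1 ^+ 2 + d) + q * (D2 ^+ 2 + d2) = 0 ->
  p0 * (D0 ^+ 4 + d ^+ 2) + p1 * (D1 ^+ 4 + d ^+ 2) + q * (D2 ^+ 4 + d2 ^+ 2)
    <= 4 * (200 * 200) ->
  `|p0 * heat (w0 + h ^+ 2 * v1) (b - h * e1)
    + p1 * heat (w0 + h ^+ 2 * v1) (b - h - h * e1)
    + q * heat (w0 + h ^+ 2 * v2) (b - h - h * e2)
    - heat (w0 + h ^+ 2 * v) (b - h * e)| <= step_const w0 * h ^+ 3.
Proof.
move=> w01 h01 p0p p1p q0 hs v_ge0 v1_ge0 v2_ge0 D0 D1 D2 d d2 m1 m2 m3.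
pose W := w0 + h ^+ 2 * v; pose X := b - h * e.
pose H := heat W X; pose A := gauss (X / Num.sqrt W) / Num.sqrt W; pose B := heat_w W X.
have hv u : 0 <= u -> w0 <= w0 + h ^+ 2 * u by move=> u0; rewrite lerDl mulr_ge0 ?sqr_ge0.
have step (D u : R) : w0 <= W + h ^+ 2 * u ->
    `|heat (W + h ^+ 2 * u) (X + - (h * D)) - H - (- (h * D)) * A
       - ((- (h * D)) ^+ 2 + h ^+ 2 * u) * B| <=
    16 / w0 ^+ 2 * (h ^+ 3 * (2 + 2 * (D ^+ 4 + u ^+ 2))).
  move=> hW; apply: (le_trans (@heat_step R w0 W X (- (h * D)) (h ^+ 2 * u) w01 (hv _ v_ge0) hW)).
  by apply: ler_wpM2l; [rewrite divr_ge0 ?sqr_ge0|exact: step_error_bound].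
have -> : w0 + h ^+ 2 * v1 = W + h ^+ 2 * d by rewrite /W /d; ring.
have -> : w0 + h ^+ 2 * v2 = W + h ^+ 2 * d2 by rewrite /W /d2; ring.
have -> : b - h * e1 = X + - (h * D0) by rewrite /X /D0; ring.
have -> : b - h - h * e1 = X + - (h * D1) by rewrite /X /D1; ring.
have -> : b - h - h * e2 = X + - (h * D2) by rewrite /X /D2; ring.
have hd : w0 <= W + h ^+ 2 * d by have := hv _ v1_ge0; rewrite /W /d; lra.
have hd2 : w0 <= W + h ^+ 2 * d2 by have := hv _ v2_ge0; rewrite /W /d2; lra.
have := step D2 d2 hd2; have := step D1 d hd; have := step D0 d hd.
have h3 : 0 <= h ^+ 3 by case/andP: h01 => h0 _; exact: exprn_ge0.
have c0 : 0 <= 16 / w0 ^+ 2 by rewrite divr_ge0 ?sqr_ge0.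
rewrite /step_const; move: (16 / w0 ^+ 2) c0 => c c0.
rewrite -/W -/X -/H; clearbody D0 D1 D2 d d2 H A B; clear step hd hd2 hv.
move: (heat _ _) (heat _ _) (heat _ _) => G2 G1 G0 s0 s1 s2.
pose e0' := G0 - H - (- (h * D0)) * A - ((- (h * D0)) ^+ 2 + h ^+ 2 * d) * B.
pose e1' := G1 - H - (- (h * D1)) * A - ((- (h * D1)) ^+ 2 + h ^+ 2 * d) * B.
pose e2' := G2 - H - (- (h * D2)) * A - ((- (h * D2)) ^+ 2 + h ^+ 2 * d2) * B.
have -> : p0 * G0 + p1 * G1 + q * G2 - H = p0 * e0' + p1 * e1' + q * e2'.
  transitivity (p0 * G0 + p1 * G1 + q * G2
     - (p0 + p1 + q) * H + h * (p0 * D0 + p1 * D1 + q * D2) * A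
     - h ^+ 2 * (p0 * (D0 ^+ 2 + d) + p1 * (D1 ^+ 2 + d) + q * (D2 ^+ 2 + d2)) * B).
    by rewrite m1 m2 hs; ring.
  by rewrite /e0' /e1' /e2'; ring.
apply: (le_trans (ler_normD _ _)); apply: (le_trans (lerD (ler_normD _ _) (lexx _))).
apply: (le_trans (lerD (lerD (ler_norm_wpM2l p0p s0) (ler_norm_wpM2l p1p s1))
  (ler_norm_wpM2l q0 s2))).
have -> : p0 * (c * (h ^+ 3 * (2 + 2 * (D0 ^+ 4 + d ^+ 2)))) +
    p1 * (c * (h ^+ 3 * (2 + 2 * (D1 ^+ 4 + d ^+ 2)))) +
    q * (c * (h ^+ 3 * (2 + 2 * (D2 ^+ 4 + d2 ^+ 2)))) =
  c * h ^+ 3 * (2 * (p0 + p1 + q) + 2 * (p0 * (D0 ^+ 4 + d ^+ 2) + p1 * (D1 ^+ 4 + d ^+ 2)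
    + q * (D2 ^+ 4 + d2 ^+ 2))) by ring.
rewrite hs mulr1 [leRHS]mulrAC; apply: ler_wpM2l; first exact: mulr_ge0.
by rewrite lerD2l ler_wpM2l.
Qed.

(** Lindeberg replacement: after each step of the chain the unrevealed part is
    replaced by a normal law with the same conditional mean and variance. The
    first two moments cancel, and n third-order errors remain. *)
Lemma lah_heat_comparison (w0 h : R) n k b :
  0 < w0 <= 1 -> 0 <= h <= 1 -> (0 < k <= n)%N ->
  `|lah_mean n k (fun j => heat w0 (b - h * j%:R))
    - heat (w0 + h ^+ 2 * lah_var n k) (b - h * lah_avg n k)|
  <= n%:R * (step_const w0 * h ^+ 3).
Proof.
move=> w01 h01; elim: n k b => [|n IH] k b; first by case: k.
have E0 : 0 <= step_const w0 * h ^+ 3.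
  by case/andP: h01 => h0 _; rewrite mulr_ge0 ?exprn_ge0 ?step_const_ge0.
case: n IH => [|m] IH kn.
  have -> : k = 1%N by case: k kn => [|[|k]].
  rewrite /lah_var /lah_avg !lah_mean_11 expr1n subrr mulr0 addr0 subrr normr0.
  by rewrite mul1r.
have [k0 kn'] := andP kn.
pose p0 : R := keep0_prob m.+1 k; pose p1 : R := keep1_prob m.+1 k; pose q := drop_prob m.+1 k.
have p0p : 0 <= p0 by exact: keep0_prob_ge0.
have p1p : 0 <= p1 by exact: keep1_prob_ge0.
have q0 : 0 <= q by exact: drop_prob_ge0.
have hs : p0 + p1 + q = 1 by exact: step_prob_sum.
pose F := fun (c : R) (j : nat) => heat w0 (c - h * j%:R).
pose G := fun (i : nat) (c : R) => heat (w0 + h ^+ 2 * lah_var m.+1 i) (c - h * lah_avg m.+1 i).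
have rec : lah_mean m.+2 k (F b) = p0 * lah_mean m.+1 k (F b)
    + p1 * lah_mean m.+1 k (F (b - h)) + q * lah_mean m.+1 k.-1 (F (b - h)).
  rewrite (@lah_mean_rec m.+1 k (F b)) //.
  have sh i : lah_mean m.+1 i (F b \o succn) = lah_mean m.+1 i (F (b - h)).
    by apply: eq_lah_mean => j; rewrite /F /= -natr1; congr heat; ring.
  by rewrite !sh.
set E := m.+1%:R * (step_const w0 * h ^+ 3).
have keep (p : R) c : 0 <= p -> (p = 0 \/ (k <= m.+1)%N) ->
    `|p * (lah_mean m.+1 k (F c) - G k c)| <= p * E.
  move=> pp [->|km]; first by rewrite !mul0r normr0.
  by apply: ler_norm_wpM2l => //; apply: IH; rewrite k0.
have keepk : p0 = 0 /\ p1 = 0 \/ (k <= m.+1)%N.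
  move: kn'; rewrite leq_eqVlt => /predU1P[kE|]; last by right.
  by left; rewrite /p0 /p1 /keep0_prob /keep1_prob kE subrr mulr0 !mul0r.
have i0 : `|p0 * (lah_mean m.+1 k (F b) - G k b)| <= p0 * E.
  by apply: keep => //; case: keepk => [[]|]; [left|right].
have i1 : `|p1 * (lah_mean m.+1 k (F (b - h)) - G k (b - h))| <= p1 * E.
  by apply: keep => //; case: keepk => [[]|]; [left|right].
have i2 : `|q * (lah_mean m.+1 k.-1 (F (b - h)) - G k.-1 (b - h))| <= q * E.
  have [k1|k1] := leqP k 1.
    have kE : k = 1%N by apply/eqP; rewrite eqn_leq k1.
    by rewrite /q kE drop_prob1 !mul0r normr0.
  apply: ler_norm_wpM2l => //; apply: IH.
  by rewrite -subn1 subn_gt0 k1 leq_subLR add1n.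
have err := @heat_chain_step w0 h b p0 p1 q _ _ _ _ _ _ w01 h01 p0p p1p q0 hs
  (lah_var_ge0 k (isT : 0 < m.+2)%N) (lah_var_ge0 k (isT : 0 < m.+1)%N)
  (lah_var_ge0 k.-1 (isT : 0 < m.+1)%N)
  (@step_centered m.+1 k isT kn) (@step_second_moment m.+1 k isT kn)
  (@step_moment_bound m.+1 k isT kn).
rewrite -/(F b) rec.
rewrite -/(G k b) -/(G k (b - h)) -/(G k.-1 (b - h)) in err.
move: i0 i1 i2 err; clear rec keep IH.
move: (lah_mean _ _ _) (lah_mean _ _ _) (lah_mean _ _ _) (G _ _) (G _ _) (G _ _) (heat _ _).
move=> M2 M1 M0 G2 G1 G0 H i0 i1 i2 err.
have -> : p0 * M0 + p1 * M1 + q * M2 - H = p0 * (M0 - G0) + p1 * (M1 - G1)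
   + q * (M2 - G2) + (p0 * G0 + p1 * G1 + q * G2 - H) by ring.
apply: (le_trans (ler_normD4 _ _ _ _)).
apply: (le_trans (lerD (lerD (lerD i0 i1) i2) err)).
by rewrite -!mulrDl hs mul1r /E -[m.+2%:R]natr1 mulrDl mul1r.
Qed.

(** * Asymptotics of the variance *)

Lemma ln_lt_sub1 a : 0 < a -> a != 1 -> ln a < a - 1.
Proof.
move=> a0 a1; rewrite -ltr_expR lnK //.
have : a - 1 != 0 by rewrite subr_eq0.
by move=> /expR_gt1Dx; rewrite addrC subrK.
Qed.

(** With l = - ln a the variance is
    a (l - (1 - a)) ((1 - a) - a l) / (1 - a)^3, and both factors are
    instances of the strict inequality ln x < x - 1. *)
Lemma lah_asymptotic_var_gt0 a : 0 < a < 1 -> 0 < lah_asymptotic_var a.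
Proof.
move=> /andP[a0 a1].
have -> : lah_asymptotic_var a =
   a / (1 - a) ^+ 3 * ((- ln a - (1 - a)) * ((1 - a) - a * - ln a)).
  by rewrite /lah_asymptotic_var; field; nonzero.
have h1 : ln a < a - 1 by apply: ln_lt_sub1; rewrite ?lt_eqF.
have h2 : - ln a < a^-1 - 1.
  by rewrite -lnV ?posrE //; apply: ln_lt_sub1; rewrite ?invr_gt0 // gt_eqF // invf_gt1.
have h3 : a * - ln a < 1 - a.
  have -> : 1 - a = a * (a^-1 - 1) by field; nonzero.
  by rewrite ltr_pM2l.
apply: mulr_gt0; first by apply: divr_gt0 => //; apply: exprn_gt0; lra.
by apply: mulr_gt0; lra.
Qed.

Lemma ln_step n : (0 < n)%N ->
  n.+1%:R^-1 <= ln (n.+1%:R : R) - ln n%:R <= n%:R^-1.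
Proof.
move=> n0; have N0 : 1 <= n%:R :> R by rewrite ler1n.
rewrite -natr1; set N : R := n%:R in N0 *.
have i1 : 0 < N^-1 by rewrite invr_gt0; lra.
have i2 : (N + 1)^-1 < 1 by rewrite invf_lt1; lra.
have i3 : 0 < (N + 1)^-1 by rewrite invr_gt0; lra.
apply/andP; split; rewrite -ln_div ?posrE; try lra.
  rewrite -lerN2 -lnV ?posrE ?divr_gt0; try lra.
  have -> : ((N + 1) / N)^-1 = 1 + - (N + 1)^-1 by field; nonzero.
  by apply: le_ln1Dx; lra.
have -> : (N + 1) / N = 1 + N^-1 by field; nonzero.
by apply: le_ln1Dx; lra.
Qed.

Lemma recip_sum_ln k n : (0 < k <= n)%N ->
  ln n.+1%:R - ln k%:R <= recip_sum k n <= k%:R^-1 + (ln n%:R - ln k%:R).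
Proof.
case/andP=> k0; elim: n => [|n IH]; first by case: k k0.
rewrite leq_eqVlt => /predU1P[->|kn].
  by rewrite recip_sum_nn subrr addr0 lexx andbT; case/andP: (@ln_step n.+1 isT).
have n0 : (0 < n)%N by apply: leq_trans k0 _.
have /andP[h1 h2] := IH kn; rewrite recip_sumS; last exact: ltnW.
have /andP[s1 s2] := ln_step n0; have /andP[s3 s4] := @ln_step n.+1 isT.
move: h1 h2 s1 s2 s3 s4.
move: (recip_sum k n) (ln n.+2%:R) (ln n.+1%:R) (ln n%:R) (ln k%:R) (n.+1%:R^-1) (n.+2%:R^-1).
move=> S l2 l1 l0 lk i1 i2 *; apply/andP; split; lra.
Qed.

Lemma recip_sum_ratio k n : (0 < k <= n)%N ->
  - ln (k%:R / n%:R) <= recip_sum k n <= n%:R^-1 / (k%:R / n%:R) - ln (k%:R / n%:R).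
Proof.
move=> kn; have /andP[h1 h2] := recip_sum_ln kn; case/andP: kn => k0 kn.
have n0 : (0 < n)%N by apply: leq_trans k0 kn.
have K0 : 0 < k%:R :> R by rewrite ltr0n.
have N0 : 0 < n%:R :> R by rewrite ltr0n.
have -> : n%:R^-1 / (k%:R / n%:R) = k%:R^-1 :> R by field; nonzero.
rewrite ln_div ?posrE //; have : ln n%:R <= ln n.+1%:R :> R.
  by rewrite ler_ln ?posrE ?ltr0n // ler_nat.
by move=> h; apply/andP; split; lra.
Qed.

Lemma cvg_invn : (n%:R^-1 : R) @[n --> \oo] --> (0 : R).
Proof.
have := @cvg_harmonic R; rewrite /harmonic => h.
by rewrite -(cvg_shiftS (fun n : nat => n%:R^-1 : R)).
Qed.

(** In this form every ingredient has a limit when k/n does: x is k/n and e is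
    1/n. *)
Lemma lah_var_ratio k n : (0 < k <= n)%N ->
  let x : R := k%:R / n%:R in let e : R := n%:R^-1 in
  let p := 1 - x + e in let a := recip_sum k n in
  let b := n%:R * recip_sqr_sum k n in
  lah_var n k / n%:R = x / (p + e) *
    ((1 + x) * a / p - (x + e ^+ 2) * b / p - (x - e) * (1 + e) * a ^+ 2 / p ^+ 2).
Proof.
move=> kn; rewrite /= lah_varE //; case/andP: kn => k0 kn.
have K0 : 1 <= k%:R :> R by rewrite ler1n.
have KN : k%:R <= n%:R :> R by rewrite ler_nat.
move: (recip_sum _ _) (recip_sqr_sum _ _) => a b.
by field; nonzero.
Qed.

Lemma cvg_lah_var (k : nat -> nat) (alpha : R) : 0 < alpha < 1 ->
  (forall n, (0 < n)%N -> (1 <= k n <= n)%N) ->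
  ((k n)%:R / n%:R : R) @[n --> \oo] --> alpha ->
  (lah_var n (k n) / n%:R : R) @[n --> \oo] --> lah_asymptotic_var alpha.
Proof.
move=> /andP[a0 a1] kn cx; have ce := cvg_invn.
set x := (fun n => _) in cx; set e := (fun n => _) in ce.
have cp : (1 - x n + e n) @[n --> \oo] --> (1 - alpha).
  rewrite -[X in _ --> X]addr0; apply: cvgD => //; apply: cvgB => //; exact: cvg_cst.
have cl : (- ln (x n)) @[n --> \oo] --> - ln alpha.
  apply: cvgN; apply: (cvg_comp x); first exact: cx.
  exact: continuous_ln.
have ca : (recip_sum (k n) n) @[n --> \oo] --> - ln alpha.
  apply: (squeeze_cvgr (f := fun n => - ln (x n))
    (h := fun n => e n / x n - ln (x n))) => //.
  - by near=> n; apply: recip_sum_ratio; apply: kn; near: n; exists 1%N.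
  - rewrite -[X in _ --> X]add0r; apply: cvgD => //.
    rewrite -(mul0r alpha^-1); apply: cvgM => //; apply: cvgV => //; exact: lt0r_neq0.
have cb : (n%:R * recip_sqr_sum (k n) n) @[n --> \oo] --> (1 - alpha) / alpha.
  apply: (squeeze_cvgr (f := fun n => (1 - x n + e n) / (x n * (1 + e n)))
    (h := fun n => (1 + e n / x n) * ((1 - x n + e n) / (x n * (1 + e n))))).
  - near=> n.
    have n0 : (0 < n)%N by near: n; exists 1%N.
    have kn' := kn n n0; have /andP[k0 kn2] := kn'.
    have K0 : 1 <= (k n)%:R :> R by rewrite ler1n.
    have KN : (k n)%:R <= n%:R :> R by rewrite ler_nat.
    have N0 : 0 < n%:R :> R by lra.
    have -> : (1 - x n + e n) / (x n * (1 + e n)) =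
       n%:R * ((n%:R - (k n)%:R + 1) / ((k n)%:R * (n%:R + 1))).
      by rewrite /x /e; field; nonzero.
    have -> : 1 + e n / x n = 1 + (k n)%:R^-1 by rewrite /x /e; field; nonzero.
    apply/andP; split; first by rewrite ler_pM2l // recip_sqr_sum_lb.
    by rewrite [leRHS]mulrCA ler_pM2l // recip_sqr_sum_ub.
  - have <- : (1 - alpha) / (alpha * (1 + 0)) = (1 - alpha) / alpha by rewrite addr0 mulr1.
    apply: cvgM => //; apply: cvgV; first by rewrite addr0 mulr1 gt_eqF.
    by apply: cvgM => //; apply: cvgD => //; exact: cvg_cst.
  - have <- : (1 + 0 / alpha) * ((1 - alpha) / (alpha * (1 + 0))) = (1 - alpha) / alpha.
      by rewrite addr0 mulr1 mul0r addr0 mul1r.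
    apply: cvgM.
      apply: cvgD; first exact: cvg_cst.
      by apply: cvgM => //; apply: cvgV => //; rewrite gt_eqF.
    apply: cvgM => //; apply: cvgV; first by rewrite addr0 mulr1 gt_eqF.
    by apply: cvgM => //; apply: cvgD => //; exact: cvg_cst.
have -> : lah_asymptotic_var alpha = alpha / (1 - alpha + 0) *
    ((1 + alpha) * (- ln alpha) / (1 - alpha) - (alpha + 0 ^+ 2) * ((1 - alpha) / alpha) / (1 - alpha)
     - (alpha - 0) * (1 + 0) * (- ln alpha) ^+ 2 / (1 - alpha) ^+ 2).
  by rewrite /lah_asymptotic_var expr0n /= !addr0 subr0; field; nonzero.
have p0 : 1 - alpha != 0 by apply: lt0r_neq0; lra.
have c1 : (1 : R) @[n --> \oo] --> (1 : R) by exact: cvg_cst.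
have csqr (u : nat -> R) (l : R) : u n @[n --> \oo] --> l -> (u n ^+ 2) @[n --> \oo] --> l ^+ 2.
  by move=> cu; rewrite expr2; under eq_fun do rewrite expr2; exact: cvgM.
have cip : (1 - x n + e n)^-1 @[n --> \oo] --> (1 - alpha)^-1 by exact: cvgV.
have lim : (x n / (1 - x n + e n + e n) *
    ((1 + x n) * recip_sum (k n) n / (1 - x n + e n)
     - (x n + e n ^+ 2) * (n%:R * recip_sqr_sum (k n) n) / (1 - x n + e n)
     - (x n - e n) * (1 + e n) * recip_sum (k n) n ^+ 2 / (1 - x n + e n) ^+ 2)) @[n --> \oo]
  --> alpha / (1 - alpha + 0) *
    ((1 + alpha) * (- ln alpha) / (1 - alpha) - (alpha + 0 ^+ 2) * ((1 - alpha) / alpha) / (1 - alpha)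
     - (alpha - 0) * (1 + 0) * (- ln alpha) ^+ 2 / (1 - alpha) ^+ 2).
  apply: cvgM.
    apply: cvgM => //; apply: cvgV; first by rewrite addr0.
    exact: cvgD.
  apply: cvgB; [apply: cvgB|].
  - apply: cvgM => //; apply: cvgM => //; exact: cvgD.
  - apply: cvgM => //; apply: cvgM => //; apply: cvgD => //; exact: csqr.
  - apply: cvgM.
      apply: cvgM; last exact: csqr.
      by apply: cvgM; [exact: cvgB|exact: cvgD].
    by apply: cvgV; [rewrite expf_neq0|exact: csqr].
apply: cvg_trans lim; apply: near_eq_cvg; near=> n.
by rewrite lah_var_ratio //; apply: kn; near: n; exists 1%N.
Unshelve. all: by end_near. Qed.

(** * Random variables with a Lah law *)

Section LahLaw.
Context d (T : measurableType d) (P : probability T R)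
  (X : {RV P >-> R}) (n k : nat) (kn : (0 < k <= n)%N)
  (lahX : lah_distributed P X n k).

Let level (j : nat) : set T := X @^-1` [set j%:R].
Let support : set T := \big[setU/set0]_(j <- index_iota k n.+1) level j.

Let measurable_level j : measurable (level j).
Proof. exact: measurable_funPTI. Qed.

Let measurable_support : measurable support.
Proof. exact: bigsetU_measurable. Qed.

Lemma lah_mean_range (F : nat -> R) :
  lah_mean n k F = \sum_(k <= j < n.+1) lah_pmf R n k j * F j.
Proof.
rewrite lah_meanE -(big_mkord xpredT (fun j => lah_pmf R n k j * F j)).
have [k0 kn'] := andP kn.
rewrite [LHS](big_cat_nat (n := k)) //=; last exact: leqW.
rewrite [X in X + _]big1_seq ?add0r // => j; rewrite mem_index_iota /= => jk.
by rewrite /lah_pmf stirling2_small // muln0 mul0r mul0r.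
Qed.

Let integral_support (g : R -> R) : measurable_fun setT g ->
  (\int[P]_(w in support) (g (X w))%:E)%E = (lah_mean n k (fun j => g j%:R))%:E.
Proof.
move=> mg.
rewrite integral_bigsetU_EFin //; first last.
- have mgX : measurable_fun [set: T] (EFin \o (fun w => g (X w))).
    by apply/measurable_EFinP; exact: (measurableT_comp mg).
  exact: (measurable_funS measurableT).
- apply/trivIsetP => i j _ _ ij; apply/seteqP; split => w //= [].
  by rewrite /level /= => -> /eqP; rewrite eqr_nat (negPf ij).
- exact: iota_uniq.
rewrite lah_mean_range -sumEFin; apply: eq_big_nat => j jkn.
rewrite (eq_integral (cst (g j%:R)%:E)); last first.
  by move=> w; rewrite inE /level /= => ->.
rewrite integral_cst // muleC EFinM; congr (_ * _)%E.
exact: lahX.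
Qed.

Let support_full : P support = 1%E.
Proof.
have : (\int[P]_(w in support) cst 1%:E w)%E = (lah_mean n k (fun=> 1))%:E.
  exact: (@integral_support (cst 1) (measurable_cst _)).
by rewrite integral_cst // mul1e lah_mean1.
Qed.

(** The prescribed masses add up to one, so X takes no other value, up to a
    null set. *)
Lemma lah_integral (g : R -> R) : measurable_fun setT g ->
  (\int[P]_w (g (X w))%:E)%E = (lah_mean n k (fun j => g j%:R))%:E.
Proof.
move=> mg; rewrite -(integral_support mg) -(setUv support).
have mgX : measurable_fun setT (fun w => (g (X w))%:E).
  by apply/measurable_EFinP/measurableT_comp.
rewrite integral_setU //; first last.
- by rewrite disj_set2E setICr.
- exact: measurable_funTS.
- exact: measurableC.
rewrite [X in (_ + X)%E]null_set_integral ?adde0 //.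
- exact: measurableC.
- exact: measurable_funTS.
- by apply: eq_trans (probability_setC P measurable_support) _; rewrite support_full subee.
Qed.

Lemma lah_expectation : fine 'E_P[X] = lah_avg n k.
Proof. by rewrite unlock (lah_integral (g := idfun) (@measurable_id _ _ _)). Qed.

Lemma lah_cdf (c x : R) : 0 < c ->
  @cdf _ _ _ P (center_scale P X c) x =
  (lah_mean n k (fun j => ((j%:R - lah_avg n k) / c <= x)%R%:R))%:E.
Proof.
move=> c0; rewrite /cdf /distribution /pushforward.
pose A : set R := `]-oo, c * x + lah_avg n k]%classic.
have -> : center_scale P X c @^-1` `]-oo, x]%classic = X @^-1` A.
  apply/seteqP; split => w /=; rewrite /center_scale lah_expectation /A /= !in_itv /=;
    by rewrite ler_pdivrMr // mulrC lerBlDr.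
have mA : measurable A by exact: measurable_itv.
have mXA : measurable (X @^-1` A) by exact: measurable_funPTI.
have mI : measurable_fun setT (\1_A : R -> R) by exact: measurable_indic.
have := lah_integral mI.
have -> : (\int[P]_w (\1_A (X w))%:E)%E = (\int[P]_w (\1_(X @^-1` A) w)%:E)%E.
  by apply: eq_integral.
rewrite integral_indic // setIT => ->.
congr EFin; apply: eq_lah_mean => j; rewrite indicE.
rewrite ler_pdivrMr // [x * c]mulrC lerBlDr.
by congr (nat_of_bool _)%:R; apply/idP/idP; rewrite inE /A /= in_itv.
Qed.

End LahLaw.

(** * Convergence of the distribution functions *)

Local Notation Phi := (@normal_cdf R 1).

Lemma continuous_Phi : continuous Phi.
Proof.
by move=> x; apply: is_derive_continuous; exact: (@is_derive_normal_cdf R 1 x (oner_neq0 _)).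
Qed.

Lemma heat_sqrE (delta y : R) : 0 < delta -> heat (delta ^+ 2) y = Phi (y / delta).
Proof. by move=> d0; rewrite /heat sqrtr_sqr gtr0_norm. Qed.

(** For y <= x the argument of Phi is at least K. *)
Lemma indicator_le_heat (delta K x y : R) : 0 < delta ->
  (y <= x)%R%:R <= heat (delta ^+ 2) (x + K * delta - y) + (1 - Phi K).
Proof.
move=> d0; rewrite heat_sqrE //.
have p0 := normal_cdf_ge0 1 ((x + K * delta - y) / delta).
have p1 := normal_cdf_le1 1 K.
case: (leP y x) => yx; last by rewrite mulr0n addr_ge0 ?subr_ge0.
rewrite mulr1n addrCA lerDl subr_ge0.
by apply: normal_cdf_nd; rewrite ler_pdivlMr //; lra.
Qed.

(** For y > x the argument of Phi is at most -K. *)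
Lemma heat_le_indicator (delta K x y : R) : 0 < delta ->
  heat (delta ^+ 2) (x - K * delta - y) - Phi (- K) <= (y <= x)%R%:R.
Proof.
move=> d0; rewrite heat_sqrE //.
have p0 := normal_cdf_ge0 1 (- K).
have p1 := normal_cdf_le1 1 ((x - K * delta - y) / delta).
case: (leP y x) => yx; first by rewrite mulr1n lerBlDr (le_trans p1) // lerDl.
rewrite mulr0n subr_le0.
by apply: normal_cdf_nd; rewrite ler_pdivrMr //; lra.
Qed.

(** Smoothing at scale delta costs a normal tail; the constant of the comparison
    with the heat flow blows up as delta tends to 0, but is divided by sqrt n. *)
Lemma lah_cdf_sandwich n k (x delta K : R) : (0 < k <= n)%N -> 0 < delta <= 1 ->
  let h := (Num.sqrt n%:R)^-1 in
  let W := delta ^+ 2 + lah_var n k / n%:R in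
  let G := lah_mean n k (fun j => ((j%:R - lah_avg n k) / Num.sqrt n%:R <= x)%R%:R) in
  heat W (x - K * delta) - Phi (- K) - step_const (delta ^+ 2) * h <= G /\
  G <= heat W (x + K * delta) + (1 - Phi K) + step_const (delta ^+ 2) * h.
Proof.
move=> kn /andP[d0 d1] h W G.
have n0 : (0 < n)%N by case/andP: kn => a b; exact: leq_trans b.
have N0 : 0 < n%:R :> R by rewrite ltr0n.
have s0 : 0 < Num.sqrt n%:R :> R by rewrite sqrtr_gt0.
have s1 : 1 <= Num.sqrt n%:R :> R by rewrite -[leLHS]sqrtr1 ler_sqrt ?ler1n.
have h01 : 0 <= h <= 1 by rewrite invr_ge0 ltW //= invf_le1.
have h2 : h ^+ 2 = n%:R^-1 by rewrite exprVn sqr_sqrtr // ltW.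
have w01 : 0 < delta ^+ 2 <= 1 by rewrite exprn_gt0 //= expr_le1 // ltW.
have E1 : lah_mean n k (fun=> 1) = 1 :> R by exact: lah_mean1.
have cmp c := @lah_heat_comparison (delta ^+ 2) h n k (c + h * lah_avg n k) w01 h01 kn.
have nh : n%:R * (step_const (delta ^+ 2) * h ^+ 3) = step_const (delta ^+ 2) * h.
  by rewrite (exprS h 2) h2; field; exact: lt0r_neq0.
have {}cmp c : `|lah_mean n k (fun j => heat (delta ^+ 2) (c - h * (j%:R - lah_avg n k)))
     - heat W c| <= step_const (delta ^+ 2) * h.
  have hW : delta ^+ 2 + h ^+ 2 * lah_var n k = W by rewrite h2 mulrC.
  have := cmp c; rewrite nh addrK hW.
  rewrite (@eq_lah_mean n k (fun j => heat (delta ^+ 2) (c + h * lah_avg n k - h * j%:R))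
    (fun j => heat (delta ^+ 2) (c - h * (j%:R - lah_avg n k)))) // => j.
  by congr heat; ring.
have ind j : (j%:R - lah_avg n k) / Num.sqrt n%:R = h * (j%:R - lah_avg n k) by rewrite mulrC.
split.
  have : lah_mean n k (fun j => heat (delta ^+ 2) (x - K * delta - h * (j%:R - lah_avg n k))
      + (- Phi (- K)) * 1) <= G.
    by apply: ler_lah_mean => j; rewrite ind mulr1; exact: heat_le_indicator.
  rewrite lah_meanD lah_meanZ E1 mulr1.
  by have := cmp (x - K * delta); rewrite ler_norml => /andP[? ?] ?; lra.
have : G <= lah_mean n k (fun j => heat (delta ^+ 2) (x + K * delta - h * (j%:R - lah_avg n k))
    + (1 - Phi K) * 1).
  by apply: ler_lah_mean => j; rewrite ind mulr1; exact: indicator_le_heat.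
rewrite lah_meanD lah_meanZ E1 mulr1.
by have := cmp (x + K * delta); rewrite ler_norml => /andP[? ?] ?; lra.
Qed.

Lemma cvg_heat {I : Type} (F : set_system I) {FF : Filter F} (w y : I -> R) (w0 y0 : R) :
  0 < w0 -> w @ F --> w0 -> y @ F --> y0 -> heat (w i) (y i) @[i --> F] --> heat w0 y0.
Proof.
move=> w00 cw cy; apply: (cvg_comp (fun i => y i / Num.sqrt (w i))); last exact: continuous_Phi.
apply: cvgM => //; apply: cvgV; first by rewrite gt_eqF // sqrtr_gt0.
by apply: (cvg_comp w (@Num.sqrt R)); [exact: cw|exact: (@sqrt_continuous R w0)].
Qed.

Lemma quarter_errors (e G A B1 B2 C1 C2 p1 p2 r : R) :
  C2 - p2 - r <= G -> G <= C1 + p1 + r ->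
  `|A - B1| <= e / 4 -> `|A - B2| <= e / 4 ->
  `|B1 - C1| <= e / 4 -> `|B2 - C2| <= e / 4 -> `|0 - r| <= e / 4 ->
  p1 <= e / 4 -> p2 <= e / 4 -> `|A - G| <= e.
Proof.
move=> lo up; rewrite !ler_norml => /andP[? ?] /andP[? ?] /andP[? ?] /andP[? ?] /andP[? ?] ? ?.
by apply/andP; split; lra.
Qed.

(** The tails fix K, the continuity of heat in both arguments then fixes delta,
    and only after that n tends to infinity. *)
Lemma cvg_lah_cdf (k : nat -> nat) (alpha x : R) : 0 < alpha < 1 ->
  (forall n, (0 < n)%N -> (1 <= k n <= n)%N) ->
  ((k n)%:R / n%:R : R) @[n --> \oo] --> alpha ->
  lah_mean n (k n) (fun j => ((j%:R - lah_avg n (k n)) / Num.sqrt n%:R <= x)%R%:R)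
    @[n --> \oo] --> normal_cdf (Num.sqrt (lah_asymptotic_var alpha)) x.
Proof.
move=> a01 kn ck; have cv := cvg_lah_var a01 kn ck.
have v0 := lah_asymptotic_var_gt0 a01; set v := lah_asymptotic_var alpha in v0 cv *.
rewrite normal_cdf_scale ?sqrtr_gt0 // -/(heat v x).
apply/cvgrPdist_le => e e0.
have e4 : 0 < e / 4 by rewrite divr_gt0.
have [K [K1 K2]] : exists K, 1 - Phi K <= e / 4 /\ Phi (- K) <= e / 4.
  have /cvgrPdist_le/(_ _ e4) h1 := @cvg_normal_cdfy R 1.
  have /cvgNy_compNP/cvgrPdist_le/(_ _ e4) h2 := @cvg_normal_cdfNy R 1.
  near (pinfty_nbhs R) => K; exists K; split.
    by apply: (le_trans (ler_norm _)); near: K.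
  by apply: (le_trans (ler_norm _)); rewrite -normrN -sub0r; near: K.
have cd (c : R) : heat (d ^+ 2 + v) (x + c * d) @[d --> 0^'+] --> heat v x.
  apply: cvg_at_right_filter.
  have -> : heat v x = heat (0 ^+ 2 + v) (x + c * 0).
    by rewrite expr0n /= add0r mulr0 addr0.
  apply: cvg_heat; first by rewrite expr0n /= add0r.
    by apply: cvgD; [exact: sqr_continuous|exact: cvg_cst].
  apply: cvgD; first exact: cvg_cst.
  by apply: cvgM; [exact: cvg_cst|exact: cvg_id].
have [delta [d01 dK dNK]] : exists delta : R, [/\ 0 < delta <= 1,
    `|heat v x - heat (delta ^+ 2 + v) (x + K * delta)| <= e / 4 &
    `|heat v x - heat (delta ^+ 2 + v) (x - K * delta)| <= e / 4].
  have /cvgrPdist_le/(_ _ e4) h1 := cd K.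
  have /cvgrPdist_le/(_ _ e4) h2 := cd (- K).
  near (0 : R)^'+ => d; exists d; split.
  - apply/andP; split; near: d; first exact: nbhs_right_gt.
    by apply: nbhs_right_ltW; exact: ltr01.
  - by near: d.
  - by rewrite -mulNr; near: d.
have cw (y : R) : heat (delta ^+ 2 + lah_var n (k n) / n%:R) y @[n --> \oo]
    --> heat (delta ^+ 2 + v) y.
  apply: cvg_heat; [|by apply: cvgD => //; exact: cvg_cst|exact: cvg_cst].
  by rewrite addr_gt0 // exprn_gt0 //; case/andP: d01.
have ch : step_const (delta ^+ 2) * (Num.sqrt n%:R)^-1 @[n --> \oo] --> (0 : R).
  rewrite -(mulr0 (step_const (delta ^+ 2))); apply: cvgM; first exact: cvg_cst.
  rewrite -(sqrtr0 R); under eq_fun do rewrite -sqrtrV //.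
  apply: (cvg_comp (fun n : nat => n%:R^-1)); first exact: cvg_invn.
  exact: sqrt_continuous.
have /cvgrPdist_le/(_ _ e4) c1 := cw (x + K * delta).
have /cvgrPdist_le/(_ _ e4) c2 := cw (x - K * delta).
have /cvgrPdist_le/(_ _ e4) c3 := ch.
near=> n.
have n0 : (0 < n)%N by near: n; exists 1%N.
have [lo up] := lah_cdf_sandwich x K (kn n n0) d01.
have t1 : `|heat (delta ^+ 2 + v) (x + K * delta)
   - heat (delta ^+ 2 + lah_var n (k n) / n%:R) (x + K * delta)| <= e / 4 by near: n.
have t2 : `|heat (delta ^+ 2 + v) (x - K * delta)
   - heat (delta ^+ 2 + lah_var n (k n) / n%:R) (x - K * delta)| <= e / 4 by near: n.
have t3 : `|0 - step_const (delta ^+ 2) * (Num.sqrt n%:R)^-1| <= e / 4 by near: n.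
exact: (quarter_errors lo up dK dNK t1 t2 t3 K1 K2).
Unshelve. all: by end_near. Qed.

End LahNumbers.

(* normal_prob takes the standard deviation, and is the normal law only when
   it is nonzero; the first conjunct is the positivity of the variance that
   the notation N(0, v) presupposes. *)
Theorem theorem5p1 (R : realType) (k : nat -> nat) (alpha : R)
    (d : nat -> measure_display) (T : forall n, measurableType (d n))
    (P : forall n, probability (T n) R) (X : forall n, {RV (P n) >-> R}) :
  0 < alpha < 1 ->
  (forall n : nat, (0 < n)%N -> (1 <= k n <= n)%N) ->
  ((k n)%:R / n%:R : R) @[n --> \oo] --> alpha ->
  (forall n : nat, (0 < n)%N -> lah_distributed (P n) (X n) n (k n)) ->
  0 < lah_asymptotic_var alpha /\
  cvg_in_distribution P (fun n => center_scale (P n) (X n) (Num.sqrt n%:R))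
    (normal_prob 0 (Num.sqrt (lah_asymptotic_var alpha))).
Proof.
move=> a01 kn ck lahX; split; first exact: lah_asymptotic_var_gt0.
move=> x _; set s := Num.sqrt (lah_asymptotic_var alpha).
rewrite [X in _ --> X](_ : _ = (normal_cdf s x)%:E); last exact: normal_probE.
have := @cvg_lah_cdf R k alpha x a01 kn ck => cG.
apply: cvg_trans (cvg_EFin _ (cG : (fine \o (EFin \o _)) @ \oo --> _)); last first.
  by near=> n.
apply: near_eq_cvg; near=> n.
have n0 : (0 < n)%N by near: n; exists 1%N.
by rewrite /= (lah_cdf (kn n n0) (lahX n n0)) // sqrtr_gt0 ltr0n.
Unshelve. all: by end_near. Qed.
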